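(* Let $\mathcal{U}_\infty$ be the universal UHF algebra and let $\alpha$ be an action of a finite group $G$ on $\mathcal{U}_\infty$. Suppose that $\alpha$ has the Rokhlin property. Then the crossed product $\mathcal{U}_\infty\rtimes_\alpha G$ is isomorphic to $\mathcal{U}_\infty$.
   Context: The universal UHF algebra $\mathcal{U}_\infty$ is the UHF algebra whose supernatural number is divisible by every power of every prime, i.e. $\mathcal{U}_\infty\cong\bigotimes_{n\ge1}M_n(\mathbb{C})$. Sequence algebras: for a C*-algebra $A$, $c_0(A)=\{(a_n)\in\ell^\infty(\mathbb{N},A): \lim_n\|a_n\|=0\}$, $A^\infty=\ell^\infty(\mathbb{N},A)/c_0(A)$; $A$ is identified with the classes of constant sequences, and $A_\infty=A^\infty\cap A'$. An automorphism $\alpha$ of $A$ induces an automorphism $\alpha_\infty$ of $A_\infty$ by entrywise application. Rokhlin property for actions: an action $\alpha$ of a finite group $G$ on a unital C*-algebra $A$ has the Rokhlin property if there is a partition of unity $\{e_g\}_{g\in G}\subset A_\infty$ consisting of projections such that $(\alpha_g)_\infty(e_h)=e_{gh}$ for all $g,h\in G$. *)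

(* Defs.v *)
From HB Require Import structures.
From mathcomp Require Import fingroup all_boot all_order all_algebra.
From mathcomp Require Import complex.
From mathcomp Require Import all_classical all_reals.
From mathcomp Require Import ereal topology normedtype sequences.

Set Implicit Arguments.
Unset Strict Implicit.
Unset Printing Implicit Defensive.

Import Order.TTheory GRing.Theory Num.Theory.
Import numFieldNormedType.Exports.

Local Open Scope classical_set_scope.
Local Open Scope ring_scope.

HB.mixin Record isStarAlgebra (K : numClosedFieldType) A
    of GRing.Algebra K A := {
  star : A -> A;
  starD : forall x y : A, star (x + y) = star x + star y;
  starZ : forall (a : K) (x : A), star (a *: x) = a^* *: star x;
  starM : forall x y : A, star (x * y) = star y * star x;
  starK : involutive star
}.

#[short(type="starAlgType")]
HB.structure Definition StarAlgebra (K : numClosedFieldType) :=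
  {A of GRing.Algebra K A & isStarAlgebra K A}.

Definition star_preserving (K : numClosedFieldType) (A B : starAlgType K)
  (f : A -> B) := forall x, f (star x) = star (f x).

(* Unital C*-algebras; since a GRing.Algebra is an nzRingType, 1 != 0.
   The norm is a plain real-valued function: normedModType R[i] cannot be joined
   with the ring structures, because numDomainType is already a join of rings
   and normed modules, in which the norm takes its values in the type itself. *)
HB.mixin Record StarAlgebra_isCStar (R : realType) A of StarAlgebra R[i] A := {
  cnorm : A -> R;
  cnormD_le : forall x y : A, cnorm (x + y) <= cnorm x + cnorm y;
  cnormZ : forall (a : R[i]) (x : A),
    (cnorm (a *: x))%:C%C = `|a| * (cnorm x)%:C%C;
  cnorm_eq0 : forall x : A, cnorm x = 0 -> x = 0;
  cnormM_le : forall x y : A, cnorm (x * y) <= cnorm x * cnorm y;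
  cnorm_star : forall x : A, cnorm (star x * x) = cnorm x ^+ 2;
  cnorm_complete : forall u : nat -> A,
    (forall e : R, 0 < e -> exists N : nat, forall m n : nat,
      (N <= m)%N -> (N <= n)%N -> cnorm (u m - u n) < e) ->
    exists l : A, (fun n => cnorm (u n - l)) @ \oo --> (0 : R)
}.

#[short(type="cstarAlgType")]
HB.structure Definition CStarAlgebra (R : realType) :=
  {A of StarAlgebra R[i] A & StarAlgebra_isCStar R A}.

Section StarTheory.
Variables (K : numClosedFieldType) (A : starAlgType K).
Implicit Types x y : A.

Lemma star0 : star (0 : A) = 0.
Proof. by apply: (addrI (star 0)); rewrite -starD !addr0. Qed.

Lemma starN x : star (- x) = - star x.
Proof. by apply: (addrI (star x)); rewrite -starD !subrr star0. Qed.

Lemma starB x y : star (x - y) = star x - star y.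
Proof. by rewrite starD starN. Qed.

Lemma star_sum I (r : seq I) (P : pred I) (F : I -> A) :
  star (\sum_(i <- r | P i) F i) = \sum_(i <- r | P i) star (F i).
Proof. exact: (big_morph _ starD star0). Qed.

Lemma star1 : star (1 : A) = 1.
Proof. by rewrite -[RHS]starK -(mul1r (star 1)) starM starK mul1r. Qed.

End StarTheory.

Section CStarTheory.
Variables (R : realType) (A : cstarAlgType R).
Implicit Types x y : A.

Lemma cnorm0 : cnorm (0 : A) = 0.
Proof.
apply: (@complexI R).
by rewrite -(scale0r (0 : A)) cnormZ normr0 mul0r.
Qed.

Lemma cnormN x : cnorm (- x) = cnorm x.
Proof.
by apply: (@complexI R); rewrite -scaleN1r cnormZ normrN normr1 mul1r.
Qed.

Lemma cnorm_ge0 x : 0 <= cnorm x.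
Proof.
have := cnormD_le x (- x); rewrite subrr cnorm0 cnormN -mulr2n.
by rewrite pmulrn_lge0.
Qed.

Lemma cnorm_starE x : cnorm (star x) = cnorm x.
Proof.
suff le y : cnorm y <= cnorm (star y).
  by apply/eqP; rewrite eq_le le andbT -{2}[x]starK le.
have [->|y0] := eqVneq y 0; first by rewrite star0.
have ny0 : 0 < cnorm y.
  by rewrite lt_neqAle cnorm_ge0 andbT eq_sym; apply: contra_neq y0 => /cnorm_eq0.
by rewrite -(ler_pM2r ny0) -expr2 -cnorm_star cnormM_le.
Qed.

End CStarTheory.

Section MatrixStar.
Variables (K : numClosedFieldType) (n : nat).
Implicit Types M N : 'M[K]_n.+1.

Definition mxstar M : 'M[K]_n.+1 := map_mx Num.conj M^T.

Fact mxstarD M N : mxstar (M + N) = mxstar M + mxstar N.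
Proof. by rewrite /mxstar linearD map_mxD. Qed.

Fact mxstarZ (a : K) M : mxstar (a *: M) = a^* *: mxstar M.
Proof. by rewrite /mxstar linearZ map_mxZ. Qed.

Fact mxstarM M N : mxstar (M * N) = mxstar N * mxstar M.
Proof. by rewrite /mxstar -[M * N]/(M *m N) trmx_mul map_mxM. Qed.

Fact mxstarK : involutive mxstar.
Proof. by move=> M; apply/matrixP=> i j; rewrite !mxE conjCK. Qed.

HB.instance Definition _ :=
  isStarAlgebra.Build K 'M[K]_n.+1 mxstarD mxstarZ mxstarM mxstarK.

End MatrixStar.

(* Isomorphisms preserve the whole structure, including the norm. *)
Record cstar_iso (R : realType) (A B : cstarAlgType R) := CStarIso {
  cstar_iso_map :> {lrmorphism A -> B};
  cstar_iso_star : star_preserving cstar_iso_map;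
  cstar_iso_norm : forall x, cnorm (cstar_iso_map x) = cnorm x;
  cstar_iso_bij : bijective cstar_iso_map
}.

Definition cstar_isomorphic (R : realType) (A B : cstarAlgType R) :=
  inhabited (cstar_iso A B).

Record uhf_tower (R : realType) (A : cstarAlgType R) := UHFTower {
  tower_dim : nat -> nat;
  tower_emb : forall n, {lrmorphism 'M[R[i]]_((tower_dim n).+1) -> A};
  tower_star : forall n, star_preserving (tower_emb n);
  tower_inj : forall n, injective (tower_emb n);
  tower_incr : forall n x, exists y, tower_emb n.+1 y = tower_emb n x;
  tower_dense : forall (a : A) (e : R), 0 < e ->
    exists n x, cnorm (a - tower_emb n x) < e
}.

(* Exponent of the prime p in the supernatural number of the tower. *)
Definition supernatural (R : realType) (A : cstarAlgType R) (T : uhf_tower A)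
    (p : nat) : \bar R :=
  ereal_sup [set ((logn p (tower_dim T n).+1)%:R)%:E | n in [set: nat]].

Definition universal_UHF (R : realType) (A : cstarAlgType R) :=
  exists T : uhf_tower A, forall p m : nat, prime p ->
    (m%:R%:E <= supernatural T p)%E.

Record cstar_action (R : realType) (G : finGroupType) (A : cstarAlgType R) :=
  CStarAction {
    act_aut :> G -> cstar_iso A A;
    act_1 : forall a, act_aut 1%g a = a;
    act_M : forall g h a, act_aut (g * h)%g a = act_aut g (act_aut h a)
  }.

Section SequenceAlgebra.
Variables (R : realType) (A : cstarAlgType R).

Definition bounded_seq : pred (nat -> A) :=
  fun x => `[< exists M : R, forall n, cnorm (x n) <= M >].

Fact bounded_seq_subring : subring_closed bounded_seq.
Proof.
split.
- by apply/asboolP; exists (cnorm (1 : A)).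
- move=> x y /asboolP[M xM] /asboolP[N yN]; apply/asboolP; exists (M + N) => n.
  by rewrite (le_trans (cnormD_le _ _)) // cnormN lerD.
- move=> x y /asboolP[M xM] /asboolP[N yN]; apply/asboolP; exists (M * N) => n.
  by rewrite (le_trans (cnormM_le _ _)) // ler_pM ?cnorm_ge0.
Qed.
HB.instance Definition _ :=
  GRing.isSubringClosed.Build (nat -> A) bounded_seq bounded_seq_subring.

(* l^oo(N, A) *)
Record linf := Linf { linf_seq :> nat -> A; linfP : linf_seq \in bounded_seq }.
HB.instance Definition _ := [isSub for linf_seq].
HB.instance Definition _ := [Choice of linf by <:].
HB.instance Definition _ := [SubChoice_isSubNzRing of linf by <:].

Definition c0 : pred linf :=
  fun x => `[< (fun n => cnorm (x n)) @ \oo --> (0 : R) >].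

Lemma c0_le (x : linf) (u : nat -> R) :
  (forall n, cnorm (x n) <= u n) -> u @ \oo --> (0 : R) -> x \in c0.
Proof.
move=> xu u0; apply/asboolP; apply: (squeeze_cvgr _ (cvg_cst 0) u0).
by apply: nearW => n; rewrite cnorm_ge0 xu.
Qed.

Fact c0_zmod : zmod_closed c0.
Proof.
split.
  by apply: (@c0_le _ (cst 0)) (cvg_cst _) => n; rewrite cnorm0.
move=> x y /asboolP x0 /asboolP y0.
apply: (@c0_le _ (fun n => cnorm (x n) + cnorm (y n))) => [n|].
  by rewrite -(cnormN (y n)) cnormD_le.
by rewrite -[0]addr0; apply: cvgD.
Qed.
HB.instance Definition _ := GRing.isZmodClosed.Build linf c0 c0_zmod.

Lemma c0Ml (x y : linf) : y \in c0 -> x * y \in c0.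
Proof.
move=> /asboolP y0; have /asboolP[M xM] := linfP x.
apply: (@c0_le _ (fun n => M * cnorm (y n))) => [n|].
  by rewrite (le_trans (cnormM_le _ _)) // ler_wpM2r ?cnorm_ge0.
by rewrite -[0](mulr0 M); apply: cvgMr.
Qed.

Lemma c0Mr (x y : linf) : x \in c0 -> x * y \in c0.
Proof.
move=> /asboolP x0; have /asboolP[M yM] := linfP y.
apply: (@c0_le _ (fun n => cnorm (x n) * M)) => [n|].
  by rewrite (le_trans (cnormM_le _ _)) // ler_wpM2l ?cnorm_ge0.
by rewrite -[0](mul0r M); apply: cvgMl.
Qed.

Fact c0_not1 : (1 : linf) \notin c0.
Proof.
apply/negP => /asboolP/cvgrPdist_lt/(_ _ ltr01) [N _ /(_ N (leqnn N))] /=.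
rewrite sub0r normrN ger0_norm ?cnorm_ge0 // => n1.
have := cnorm_star (1 : A); rewrite star1 mulr1 => /eqP.
rewrite eq_sym expr2 -subr_eq0 -{3}[cnorm 1]mulr1 -mulrBr mulf_eq0 subr_eq0.
case/orP => /eqP; last by move=> E; rewrite E ltxx in n1.
by move/cnorm_eq0/eqP; rewrite oner_eq0.
Qed.

Local Open Scope quotient_scope.

(* A^oo = l^oo(N, A) / c_0(A) *)
Definition seq_alg := Quotient.quot (GRing.ZmodClosed.clone linf c0 _).
HB.instance Definition _ := GRing.Zmodule.on seq_alg.
HB.instance Definition _ := EqQuotient.on seq_alg.

Lemma seq_alg_eqP (x y : linf) :
  reflect (\pi_seq_alg x = \pi_seq_alg y) (x - y \in c0).
Proof. by rewrite Quotient.idealrBE; apply: eqP. Qed.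

Definition seq_alg_one : seq_alg := \pi_seq_alg 1.
Definition seq_alg_mul := lift_op2 seq_alg *%R.

Fact pi_seq_mul (x y : linf) :
  \pi_seq_alg (x * y) = seq_alg_mul (\pi_seq_alg x) (\pi_seq_alg y).
Proof.
unlock seq_alg_mul; apply/seq_alg_eqP.
set x' := repr _; set y' := repr _.
have xx' : x - x' \in c0 by apply/seq_alg_eqP; rewrite reprK.
have yy' : y - y' \in c0 by apply/seq_alg_eqP; rewrite reprK.
have -> : x * y - x' * y' = x * (y - y') + (x - x') * y'.
  by rewrite mulrBr mulrBl addrA subrK.
by apply: rpredD; [apply: c0Ml | apply: c0Mr].
Qed.

Fact pi_seq_add (x y : linf) : \pi_seq_alg (x + y) = \pi_seq_alg x + \pi_seq_alg y.
Proof. exact: Quotient.pi_add. Qed.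

Fact seq_mulA : associative seq_alg_mul.
Proof.
by elim/quotW=> x; elim/quotW=> y; elim/quotW=> z; rewrite -!pi_seq_mul mulrA.
Qed.

Fact seq_mul1 : left_id seq_alg_one seq_alg_mul.
Proof. by elim/quotW=> x; rewrite -pi_seq_mul mul1r. Qed.

Fact seq_mulr1 : right_id seq_alg_one seq_alg_mul.
Proof. by elim/quotW=> x; rewrite -pi_seq_mul mulr1. Qed.

Fact seq_mulDl : left_distributive seq_alg_mul +%R.
Proof.
elim/quotW=> x; elim/quotW=> y; elim/quotW=> z.
by rewrite -pi_seq_add -!pi_seq_mul -pi_seq_add mulrDl.
Qed.

Fact seq_mulDr : right_distributive seq_alg_mul +%R.
Proof.
elim/quotW=> x; elim/quotW=> y; elim/quotW=> z.
by rewrite -pi_seq_add -!pi_seq_mul -pi_seq_add mulrDr.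
Qed.

Fact seq_one_neq0 : seq_alg_one != 0.
Proof.
apply: contraNneq c0_not1 => /esym E; rewrite -[1]subr0; apply/seq_alg_eqP.
by rewrite -[LHS]/seq_alg_one -E; apply: esym; apply: lock.
Qed.

HB.instance Definition _ := GRing.Zmodule_isNzRing.Build seq_alg
  seq_mulA seq_mul1 seq_mulr1 seq_mulDl seq_mulDr seq_one_neq0.

(* Entrywise application of a norm-preserving additive map, which sends l^oo to
   l^oo and c_0 to c_0 and hence acts on classes. *)
Section Entrywise.
Variable f : A -> A.
Hypotheses (fN : forall x, cnorm (f x) = cnorm x) (fB : {morph f : x y / x - y}).

Fact entrywise_subproof (x : linf) : f \o x \in bounded_seq.
Proof.
have /asboolP[M xM] := linfP x; apply/asboolP.
by exists M => n /=; rewrite fN.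
Qed.
Definition linf_entrywise (x : linf) := Linf (entrywise_subproof x).
Definition seq_entrywise := lift_op1 seq_alg linf_entrywise.

Lemma pi_entrywise (x : linf) :
  seq_entrywise (\pi_seq_alg x) = \pi_seq_alg (linf_entrywise x).
Proof.
unlock seq_entrywise; apply/seq_alg_eqP; set y := repr _.
have : y - x \in c0 by apply/seq_alg_eqP; rewrite reprK.
move=> /asboolP yx0; apply/asboolP; apply: cvg_trans yx0.
apply: near_eq_cvg; apply: nearW => n; rewrite -[LHS]fN.
by congr cnorm; apply: fB.
Qed.
End Entrywise.

Definition seq_star : seq_alg -> seq_alg := seq_entrywise (@cnorm_starE R A).

Fact const_seq_subproof (a : A) : (fun=> a) \in bounded_seq.
Proof. by apply/asboolP; exists (cnorm a). Qed.
Definition seq_const (a : A) : seq_alg := \pi_seq_alg (Linf (const_seq_subproof a)).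

(* A_oo = A^oo `&` A' *)
Definition central_seq_alg : set seq_alg :=
  [set x | forall a : A, x * seq_const a = seq_const a * x].

Definition seq_projection (e : seq_alg) := e * e = e /\ seq_star e = e.

End SequenceAlgebra.

Definition seq_act (R : realType) (G : finGroupType) (A : cstarAlgType R)
    (alpha : cstar_action G A) (g : G) : seq_alg A -> seq_alg A :=
  seq_entrywise (cstar_iso_norm (alpha g)).

(* A partition of unity consisting of projections: pairwise orthogonal
   projections with sum 1. *)
Definition Rokhlin (R : realType) (G : finGroupType) (A : cstarAlgType R)
    (alpha : cstar_action G A) :=
  exists e : G -> seq_alg A,
    [/\ forall g, central_seq_alg (e g),
        forall g, seq_projection (e g),
        forall g h, g != h -> e g * e h = 0,
        \sum_(g : G) e g = 1
      & forall g h, seq_act alpha g (e h) = e (g * h)%g].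

(* The convolution algebra C_c(G, A), which for a finite group G consists of all
   functions G -> A:
     (f1 * f2)(s) = \sum_t f1(t) alpha_t(f2(t^-1 s)),
     f^*(s) = alpha_s(f(s^-1)^* ). *)
Definition conv_alg (R : realType) (G : finGroupType) (A : cstarAlgType R)
  (alpha : cstar_action G A) := {ffun G -> A}.

Section Convolution.
Variables (R : realType) (G : finGroupType) (A : cstarAlgType R).
Variable alpha : cstar_action G A.
Local Notation C := (conv_alg alpha).
HB.instance Definition _ := GRing.Lmodule.copy C {ffun G -> A}.
Implicit Types x y z : C.

Definition conv_one : C := [ffun s => if s == 1%g then 1 else 0].
Definition conv_mul x y : C :=
  [ffun s => \sum_(t : G) x t * alpha t (y (t^-1 * s)%g)].
Definition conv_star x : C := [ffun s => alpha s (star (x s^-1%g))].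

Fact conv_mulA : associative conv_mul.
Proof.
move=> x y z; apply/ffunP=> s; rewrite !ffunE.
under [RHS]eq_bigr do rewrite ffunE mulr_suml.
rewrite exchange_big /=; apply: eq_bigr => t _; rewrite ffunE raddf_sum mulr_sumr.
rewrite (reindex_inj (mulgI t^-1%g)) /=; apply: eq_bigr => u _.
by rewrite rmorphM /= -act_M mulrA mulKVg invMg invgK -!mulgA mulKVg.
Qed.

Fact conv_mul1 : left_id conv_one conv_mul.
Proof.
move=> x; apply/ffunP=> s; rewrite ffunE (bigD1 1%g) //= big1 => [|t /negPf t1].
  by rewrite ffunE eqxx mul1r act_1 invg1 mul1g addr0.
by rewrite ffunE t1 mul0r.
Qed.

Fact conv_mulr1 : right_id conv_one conv_mul.
Proof.
move=> x; apply/ffunP=> s; rewrite ffunE (bigD1 s) //= big1 => [|t ts].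
  by rewrite ffunE mulVg eqxx rmorph1 mulr1 addr0.
by rewrite ffunE -eq_mulVg1 (negPf ts) raddf0 mulr0.
Qed.

Fact conv_mulDl : left_distributive conv_mul +%R.
Proof.
move=> x y z; apply/ffunP=> s; rewrite !ffunE -big_split /=.
by apply: eq_bigr => t _; rewrite ffunE mulrDl.
Qed.

Fact conv_mulDr : right_distributive conv_mul +%R.
Proof.
move=> x y z; apply/ffunP=> s; rewrite !ffunE -big_split /=.
by apply: eq_bigr => t _; rewrite ffunE raddfD mulrDr.
Qed.

Fact conv_one_neq0 : conv_one != 0.
Proof.
apply/eqP=> /ffunP/(_ 1%g); rewrite !ffunE eqxx => /eqP.
by rewrite oner_eq0.
Qed.

HB.instance Definition _ := GRing.Zmodule_isNzRing.Build C
  conv_mulA conv_mul1 conv_mulr1 conv_mulDl conv_mulDr conv_one_neq0.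

Fact conv_scaleAl (a : R[i]) x y : a *: (x * y) = a *: x * y.
Proof.
apply/ffunP=> s; rewrite !ffunE scaler_sumr.
by apply: eq_bigr => t _; rewrite ffunE scalerAl.
Qed.
HB.instance Definition _ := GRing.Lmodule_isLalgebra.Build R[i] C conv_scaleAl.

Fact conv_scaleAr (a : R[i]) x y : a *: (x * y) = x * (a *: y).
Proof.
apply/ffunP=> s; rewrite !ffunE scaler_sumr.
by apply: eq_bigr => t _; rewrite ffunE linearZ scalerAr.
Qed.
HB.instance Definition _ := GRing.Lalgebra_isAlgebra.Build R[i] C conv_scaleAr.

Fact conv_starD x y : conv_star (x + y) = conv_star x + conv_star y.
Proof. by apply/ffunP=> s; rewrite !ffunE starD raddfD. Qed.

Fact conv_starZ (a : R[i]) x : conv_star (a *: x) = a^* *: conv_star x.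
Proof. by apply/ffunP=> s; rewrite !ffunE starZ linearZ. Qed.

Fact conv_starM x y : conv_star (x * y) = conv_star y * conv_star x.
Proof.
apply/ffunP=> s; rewrite !ffunE star_sum raddf_sum.
rewrite (reindex_inj (mulgI s^-1%g)) /=; apply: eq_bigr => t _.
rewrite !ffunE starM rmorphM /= -!cstar_iso_star -!act_M.
by rewrite !mulKVg !invMg !invgK mulgK.
Qed.

Fact conv_starK : involutive conv_star.
Proof.
move=> x; apply/ffunP=> s.
by rewrite !ffunE -cstar_iso_star starK invgK -act_M mulgV act_1.
Qed.

HB.instance Definition _ :=
  isStarAlgebra.Build R[i] C conv_starD conv_starZ conv_starM conv_starK.

End Convolution.

(* Nondegenerate covariant representations.  Arbitrary unital C*-algebras D are
   used as targets instead of the algebras B(H) only: as each D embeds unitally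
   into some B(H), this gives the same universal norm. *)
Record covariant_rep (R : realType) (G : finGroupType) (A : cstarAlgType R)
    (alpha : cstar_action G A) (D : cstarAlgType R) := CovariantRep {
  cov_pi : {lrmorphism A -> D};
  cov_u : G -> D;
  cov_pi_star : star_preserving cov_pi;
  cov_u_unitary : forall g,
    star (cov_u g) * cov_u g = 1 /\ cov_u g * star (cov_u g) = 1;
  cov_uM : forall g h, cov_u (g * h)%g = cov_u g * cov_u h;
  covariance : forall g a,
    cov_pi (alpha g a) = cov_u g * cov_pi a * star (cov_u g)
}.

Definition integrated_form (R : realType) (G : finGroupType)
    (A : cstarAlgType R) (alpha : cstar_action G A) (D : cstarAlgType R)
    (r : covariant_rep alpha D) (f : conv_alg alpha) : D :=
  \sum_(g : G) cov_pi r (f g) * cov_u r g.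

Definition universal_norm (R : realType) (G : finGroupType)
    (A : cstarAlgType R) (alpha : cstar_action G A) (f : conv_alg alpha) : R :=
  sup [set x | exists (D : cstarAlgType R) (r : covariant_rep alpha D),
                 x = cnorm (integrated_form r f)].

(* (B, j) is a crossed product of A by alpha, i.e. a completion of the convolution
   algebra for the universal norm; this determines B up to isomorphism. *)
Record crossed_product (R : realType) (G : finGroupType) (A : cstarAlgType R)
    (alpha : cstar_action G A) (B : cstarAlgType R)
    (j : {lrmorphism conv_alg alpha -> B}) : Prop := CrossedProduct {
  cp_star : star_preserving j;
  cp_norm : forall f, cnorm (j f) = universal_norm f;
  cp_dense : forall (b : B) (e : R), 0 < e -> exists f, cnorm (b - j f) < e
}.

(* Main.v *)
(* A universal UHF algebra U is locally matricial: finite sets are approximated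
   by unital matrix subalgebras, whose sizes can be taken divisible by any N.  By
   Elliott's intertwining argument this property, together with separability,
   determines the algebra: systems of matrix units can be extended alternately on
   both sides, since two embeddings of M_n into M_m are unitarily equivalent and
   matrix units are stable under small perturbations.
   So it suffices that B = U x| G is again locally matricial.  The Rokhlin property
   provides a projection p in U, almost commuting with a given finite set, whose
   translates alpha_g(p) = u_g p u_g^* are almost orthogonal with sum almost 1.
   Correcting the u_g p to exact partial isometries f_g embeds M_G (x) pUp unitally
   in B, with an image close to the given elements, and the corner pUp is itself
   approximated by matrix algebras.  Divisibility of the sizes is inherited from
   the unital embedding of U in B. *)
Require Import Defs.
From HB Require Import structures.
From mathcomp Require Import fingroup all_boot all_order all_algebra.
From mathcomp Require Import complex.
From mathcomp Require Import all_classical all_reals.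
From mathcomp Require ereal spectral.
From mathcomp Require Import topology normedtype sequences.
From mathcomp Require Import ring lra.
From Stdlib Require Ncring Ncring_tac.

Set Implicit Arguments.
Unset Strict Implicit.
Unset Printing Implicit Defensive.

Import Order.TTheory GRing.Theory Num.Theory.
Import numFieldNormedType.Exports.

Local Open Scope classical_set_scope.
Local Open Scope ring_scope.

(** Functional calculus is replaced by one fixed point, [inverse_square_root]: approximate
    projections, partial isometries and matrix units are corrected through it. As a limit of
    polynomials in its argument it stays in every closed subalgebra containing that argument; hence
    the predicate [S] in the perturbation results, later taken to be the range of a matrix algebra.
    Sharp norm bounds (star morphisms are contractive, matrices have a unique C*-norm) come from
    crude ones, whose constant disappears along the powers of exponent 2^k of a self-adjoint
    element. The size condition is forced by the intertwining: a matrix algebra found on one side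
    has to embed unitally in one of the other side, so its size must divide the next one.
    Perturbation makes each extension exact, so the stages are an increasing chain of isometric
    graphs and only their union needs closing. The corner of p is not studied as an algebra: a
    partial isometry of U carries p to a projection of a matrix subalgebra, whose corner is visibly
    matricial. *)

(* [ring] only covers commutative rings. *)
#[local] Instance nz_ring_ops (T : nzRingType) :
  @Ncring.Ring_ops T 0 1 +%R *%R (fun x y => x - y) -%R eq := {}.

#[local] Instance nz_ring (T : nzRingType) : Ncring.Ring (Ro := nz_ring_ops T).
Proof.
split; try exact _; try by move=> ? ? -> // ? ? ->.
- exact: add0r.
- exact: addrC.
- exact: addrA.
- exact: mul1r.
- exact: mulr1.
- exact: mulrA.
- exact: mulrDl.
- by move=> x y z; exact: mulrDr.
- by [].
- exact: subrr.
Qed.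

Ltac ncring := Ncring_tac.non_commutative_ring.

(** * Norm estimates *)

(** Removes the constant from a norm comparison: by the C*-identity the norm of a self-adjoint
    element commutes with powers of exponent 2^k. If [b < a], the powers of [a / b] are unbounded by
    Bernoulli's inequality. *)
Lemma le_of_exp2n_le (R : realType) (a b C : R) : 0 <= a -> 0 <= b ->
  (forall k, a ^+ (2 ^ k) <= C * b ^+ (2 ^ k)) -> a <= b.
Proof.
move=> a0 b0 abC; rewrite leNgt; apply/negP => ba.
have b1 : 0 < b.
  rewrite lt_neqAle b0 andbT; apply/eqP => b_0; have := abC 1%N.
  rewrite -b_0 expr0n /= mulr0 leNgt; apply/negP; rewrite negbK exprn_gt0 //.
  exact: le_lt_trans ba.
pose t := a / b.
have t1 : 1 < t by rewrite ltr_pdivlMr // mul1r.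
have tC k : t ^+ (2 ^ k) <= C.
  by rewrite expr_div_n ler_pdivrMr ?exprn_gt0.
have bern n : 1 + n%:R * (t - 1) <= t ^+ n.
  elim: n => [|n IH]; first by rewrite mul0r addr0 expr0.
  rewrite exprS; apply: le_trans (ler_wpM2l _ IH); last by lra.
  rewrite -natr1; have := mulr_ge0 (ler0n R n) (sqr_ge0 (t - 1)); rewrite expr2; nra.
have := Num.Theory.archi_boundP (_ : 0 <= `|C| / (t - 1)).
rewrite divr_ge0 // ?subr_ge0 ?(ltW t1) // => /(_ isT); set n := Num.bound _.
rewrite ltr_pdivrMr ?subr_gt0 // => Cn.
have := le_trans (bern (2 ^ n)%N) (tC n); apply/negP; rewrite -ltNge.
apply: le_lt_trans (ler_norm _) _; apply: lt_le_trans Cn _.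
rewrite -[leLHS]add0r lerD // ler_wpM2r ?subr_ge0 ?(ltW t1) // ler_nat.
exact/ltnW/ltn_expl.
Qed.

Section Norm.
Variables (R : realType) (X : cstarAlgType R).
Implicit Types x y z : X.

Lemma cnorm1 : cnorm (1 : X) = 1.
Proof.
have := cnorm_star (1 : X); rewrite star1 mulr1 expr2 => /esym/eqP.
rewrite -subr_eq0 -{3}[cnorm 1]mulr1 -mulrBr mulf_eq0 subr_eq0.
by case/orP => /eqP // /cnorm_eq0/eqP; rewrite oner_eq0.
Qed.

Lemma cnormZr (a : R[i]) x : cnorm (a *: x) = Normc.normc a * cnorm x.
Proof. by apply: (@complexI R); rewrite cnormZ rmorphM. Qed.

Lemma cnormB_le x y : cnorm (x - y) <= cnorm x + cnorm y.
Proof. by rewrite -(cnormN y) cnormD_le. Qed.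

Lemma cnorm_distC x y : cnorm (x - y) = cnorm (y - x).
Proof. by rewrite -cnormN opprB. Qed.

Lemma cnorm_dist_trans y x z : cnorm (x - z) <= cnorm (x - y) + cnorm (y - z).
Proof. by rewrite (le_trans _ (cnormD_le _ _)) // addrA subrK. Qed.

Lemma cnorm_le_dist x y : cnorm x <= cnorm (x - y) + cnorm y.
Proof. by rewrite -{1}(subrK y x) cnormD_le. Qed.

Lemma cnorm_sum_le I (r : seq I) (P : pred I) (F : I -> X) :
  cnorm (\sum_(i <- r | P i) F i) <= \sum_(i <- r | P i) cnorm (F i).
Proof.
elim/big_ind2: _ => [|x a y b xa yb|//]; first by rewrite cnorm0.
by rewrite (le_trans (cnormD_le _ _)) // lerD.
Qed.

Lemma cnormM_le_of x y (a b : R) :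
  cnorm x <= a -> cnorm y <= b -> cnorm (x * y) <= a * b.
Proof. by move=> xa yb; rewrite (le_trans (cnormM_le _ _)) ?ler_pM ?cnorm_ge0. Qed.

Lemma cnormM_dist_le x y x' y' :
  cnorm (x * y - x' * y') <= cnorm (x - x') * cnorm y + cnorm x' * cnorm (y - y').
Proof.
have -> : x * y - x' * y' = (x - x') * y + x' * (y - y') by ncring.
by rewrite (le_trans (cnormD_le _ _)) // lerD // cnormM_le.
Qed.

Lemma cnorm_eq_small x : (forall e : R, 0 < e -> cnorm x < e) -> x = 0.
Proof.
move=> xe; apply: cnorm_eq0; apply/eqP; rewrite eq_le cnorm_ge0 andbT leNgt.
by apply/negP => /xe; rewrite ltxx.
Qed.

Lemma cnorm_unitary x : star x * x = 1 -> cnorm x = 1.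
Proof.
move=> xx; apply/eqP; rewrite -(@eqrXn2 _ 2) ?cnorm_ge0 // -cnorm_star xx.
by rewrite cnorm1 expr1n.
Qed.

Lemma cnorm_sqr x : star x = x -> cnorm (x * x) = cnorm x ^+ 2.
Proof. by move=> sx; rewrite -{1}sx cnorm_star. Qed.

Lemma star_exp x n : star (x ^+ n) = star x ^+ n.
Proof.
elim: n => [|n IH]; first by rewrite !expr0 star1.
by rewrite exprSr starM IH -exprS.
Qed.

Lemma cnorm_exp2n x k : star x = x -> cnorm (x ^+ (2 ^ k)) = cnorm x ^+ (2 ^ k).
Proof.
move=> sx; elim: k => [|k IH]; first by rewrite expn0 !expr1.
by rewrite expnSr !exprM expr2 cnorm_sqr ?IH // star_exp sx.
Qed.

Definition closed_set (S : X -> Prop) :=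
  forall x, (forall e : R, 0 < e -> exists2 y, S y & cnorm (x - y) < e) -> S x.

(** Stability under [star] is not asked, so that the commutant of an arbitrary element qualifies;
    this instance shows that limits of polynomials commute with what their argument commutes
    with. *)
Record closed_subalg (S : X -> Prop) : Prop := ClosedSubalg {
  csub1 : S 1;
  csubD : forall x y, S x -> S y -> S (x + y);
  csubZ : forall (a : R[i]) x, S x -> S (a *: x);
  csubM : forall x y, S x -> S y -> S (x * y);
  csub_closed : closed_set S }.

Lemma csubN S x : closed_subalg S -> S x -> S (- x).
Proof. by move=> hS Sx; rewrite -scaleN1r; exact: csubZ. Qed.

Lemma csubB S x y : closed_subalg S -> S x -> S y -> S (x - y).
Proof. by move=> hS Sx Sy; apply: (csubD hS) => //; exact: csubN. Qed.

Lemma csub_sum S I (r : seq I) (P : pred I) (F : I -> X) : closed_subalg S ->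
  (forall i, P i -> S (F i)) -> S (\sum_(i <- r | P i) F i).
Proof.
move=> hS SF; elim/big_ind: _ => //; last exact: csubD.
by rewrite -(scale0r 1); apply: (csubZ hS); exact: csub1.
Qed.

Lemma commutant_closed_subalg c : closed_subalg (fun x => c * x = x * c).
Proof.
split=> [|x y cx cy|a x cx|x y cx cy|x xc].
- by rewrite mulr1 mul1r.
- by rewrite mulrDr mulrDl cx cy.
- by rewrite -scalerAr -scalerAl cx.
- by rewrite mulrA cx -mulrA cy mulrA.
apply/eqP; rewrite -subr_eq0; apply/eqP/cnorm_eq_small => e e0.
pose d := e / (2 * cnorm c + 1); have c0 := cnorm_ge0 c.
have d0 : 0 < d by rewrite divr_gt0 //; lra.
have [y cy xy] := xc d d0.
have -> : c * x - x * c = c * (x - y) - (x - y) * c + (c * y - y * c) by ncring.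
rewrite cy subrr addr0.
apply: le_lt_trans (cnormB_le _ _) _.
have cde : d * (2 * cnorm c + 1) = e by rewrite divfK //; apply/eqP; lra.
have := cnormM_le c (x - y); have := cnormM_le (x - y) c.
have := cnorm_ge0 (x - y); nra.
Qed.

Lemma cnorm_completeN (u : nat -> X) :
  (forall e : R, 0 < e -> exists N : nat, forall m n : nat,
      (N <= m)%N -> (N <= n)%N -> cnorm (u m - u n) < e) ->
  exists l : X, forall e : R, 0 < e ->
    exists N : nat, forall n, (N <= n)%N -> cnorm (u n - l) < e.
Proof.
move=> /cnorm_complete[l ul]; exists l => e e0.
move/cvgrPdist_lt: ul => /(_ e e0)[N _ Nu]; exists N => n /Nu /=.
by rewrite sub0r normrN ger0_norm ?cnorm_ge0.
Qed.

Lemma contraction_limit (u : nat -> X) (C q : R) : 0 <= q < 1 ->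
  (forall n, cnorm (u n.+1 - u n) <= C * q ^+ n) ->
  exists l : X, forall e : R, 0 < e ->
    exists N : nat, forall n, (N <= n)%N -> cnorm (u n - l) < e.
Proof.
move=> /andP[q0 q1] uq; apply: cnorm_completeN => e e0.
have C0 : 0 <= C.
  by have := uq 0%N; rewrite expr0 mulr1; apply: le_trans; apply: cnorm_ge0.
have q'0 : 0 < 1 - q by lra.
have tail m k : cnorm (u (m + k)%N - u m) * (1 - q) <= C * q ^+ m * (1 - q ^+ k).
  elim: k => [|k IH]; first by rewrite addn0 subrr cnorm0 mul0r expr0 subrr mulr0.
  rewrite addnS.
  have := cnorm_dist_trans (u (m + k)%N) (u (m + k).+1) (u m).
  have := uq (m + k)%N; rewrite exprD exprS.
  have := exprn_ge0 m q0; have := exprn_ge0 k q0.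
  set a := q ^+ m in IH *; set b := q ^+ k in IH * => _ _ h1 h2.
  have h3 := ler_wpM2r (ltW q'0) h1.
  by apply: le_trans (ler_wpM2r (ltW q'0) h2) _; nra.
(* [2 * C] because both [u m] and [u n] are compared with [u N]; the [+ 1] keeps the divisor
   positive. *)
have /cvgrPdist_lt/(_ (e * (1 - q) / (2 * C + 1))) :
    (fun n => q ^+ n) @ \oo --> (0 : R).
  by apply: cvg_expr; rewrite ger0_norm.
have C1 : 0 < 2 * C + 1 by lra.
have d0 : 0 < e * (1 - q) / (2 * C + 1) by rewrite divr_gt0 // mulr_gt0.
move=> /(_ d0)[N _ Nq]; exists N => m n Nm Nn.
have qN : (2 * C + 1) * q ^+ N < e * (1 - q).
  have := Nq N (leqnn N); rewrite /= sub0r normrN ger0_norm ?exprn_ge0 //.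
  by rewrite ltr_pdivlMr // mulrC.
have tailN k : (N <= k)%N -> cnorm (u k - u N) * (1 - q) <= C * q ^+ N.
  move=> Nk; rewrite -(subnKC Nk); apply: le_trans (tail _ _) _.
  have a0 := exprn_ge0 N q0; have b0 := exprn_ge0 (k - N) q0.
  by have := mulr_ge0 C0 a0; nra.
have := cnorm_dist_trans (u N) (u m) (u n); rewrite (cnorm_distC (u N)).
have := tailN m Nm; have := tailN n Nn; have := exprn_ge0 N q0 => hq hn hm h.
rewrite -(ltr_pM2r q'0); apply: le_lt_trans (ler_wpM2r (ltW q'0) h) _.
by rewrite mulrDl; lra.
Qed.

End Norm.

(** * Inverse square roots near 1 *)

Section InverseSquareRoot.
Variables (R : realType) (X : cstarAlgType R).
Implicit Types x y z h s t : X.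

Lemma cnorm_half x : cnorm (2^-1 *: x) = cnorm x / 2.
Proof.
have two_ne0 : (2 : R[i]) != 0 by rewrite pnatr_eq0.
have -> : (2^-1 : R[i]) = (2^-1)%:C%C by rewrite fmorphV rmorph_nat.
rewrite cnormZr /= expr0n /= addr0 sqrtr_sqr.
by rewrite ger0_norm ?invr_ge0 ?ler0n // mulrC.
Qed.

Lemma half_double x : 2^-1 *: x + 2^-1 *: x = x.
Proof.
rewrite -scalerDl -[X in X *: _]mulr2n -[X in X *: _]mulr_natr.
by rewrite mulVf ?scale1r // pnatr_eq0.
Qed.

Lemma star_half x : star (2^-1 *: x) = 2^-1 *: star x.
Proof. by rewrite starZ fmorphV rmorph_nat. Qed.

(* Fixed points [t] of this map solve [(1 + t) (1 - h) (1 + t) = 1]. *)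
Definition invsqrt_step h t := 2^-1 *: (h + t * h + h * t - t * t + t * h * t).

Lemma star_invsqrt_step h t : star h = h -> star t = t ->
  star (invsqrt_step h t) = invsqrt_step h t.
Proof.
move=> sh st; rewrite star_half !(starB, starD, starM) !mulrA sh st.
by rewrite (addrAC h (h * t)).
Qed.

Lemma invsqrt_step_closed S h t : closed_subalg S -> S h -> S t ->
  S (invsqrt_step h t).
Proof.
move=> hS Sh St; have [SM SD] := (csubM hS, csubD hS).
have Sth := SM _ _ St Sh; have Sht := SM _ _ Sh St.
apply: (csubZ hS); apply: (SD); last exact: SM.
by apply: (csubB hS); [apply: (SD); [apply: (SD)|] | apply: SM].
Qed.

Lemma invsqrt_step_bound h t : cnorm h <= 4^-1 -> cnorm t <= cnorm h ->
  cnorm (invsqrt_step h t) <= cnorm h.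
Proof.
move=> h4 th; rewrite cnorm_half; set d := cnorm h in h4 th *.
have d0 : 0 <= d := cnorm_ge0 h; have t0 := cnorm_ge0 t.
have e1 := cnormM_le_of th (lexx (cnorm h)).
have e2 := cnormM_le_of (lexx (cnorm h)) th.
have e3 := cnormM_le_of th th; have e4 := cnormM_le_of e1 th.
have f1 := cnormD_le (h + t * h + h * t - t * t) (t * h * t).
have f2 := cnormB_le (h + t * h + h * t) (t * t).
have f3 := cnormD_le (h + t * h) (h * t); have f4 := cnormD_le h (t * h).
rewrite -/d in e1 e2 e3 e4 f1 f2 f3 f4 *.
have e5 : d * d <= d / 4 by apply: ler_wpM2l.
have e6 : d * d * d <= d / 16 by apply: le_trans (ler_wpM2r d0 e5) _; lra.
by lra.
Qed.

(** In the expanded difference four terms are at most [cnorm k / 4] and two at most [cnorm k / 16];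
    half of the total 9/8 is the ratio 9/16. *)
Lemma invsqrt_step_lip h s t : cnorm h <= 4^-1 -> cnorm s <= cnorm h ->
  cnorm t <= cnorm h ->
  cnorm (invsqrt_step h s - invsqrt_step h t) <= 9 / 16 * cnorm (s - t).
Proof.
move=> h4 sh th; rewrite -scalerBr cnorm_half; set k := s - t.
have -> : h + s * h + h * s - s * s + s * h * s -
    (h + t * h + h * t - t * t + t * h * t) =
    k * h + h * k - s * k - k * t + k * (h * s) + t * h * k by rewrite /k; ncring.
set d := cnorm h in h4 sh th *.
have d0 : 0 <= d := cnorm_ge0 h; have k0 := cnorm_ge0 k.
have lk := lexx (cnorm k); have lh := lexx (cnorm h).
have e1 := cnormM_le_of lk lh; have e2 := cnormM_le_of lh lk.
have e3 := cnormM_le_of sh lk; have e4 := cnormM_le_of lk th.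
have e5 := cnormM_le_of lk (cnormM_le_of lh sh).
have e6 := cnormM_le_of (cnormM_le_of th lh) lk.
have f1 := cnormD_le (k * h + h * k - s * k - k * t + k * (h * s)) (t * h * k).
have f2 := cnormD_le (k * h + h * k - s * k - k * t) (k * (h * s)).
have f3 := cnormB_le (k * h + h * k - s * k) (k * t).
have f4 := cnormB_le (k * h + h * k) (s * k).
have f5 := cnormD_le (k * h) (h * k).
rewrite -/d in e1 e2 e3 e4 e5 e6 f1 f2 f3 f4 f5 *.
have kd : cnorm k * d <= cnorm k / 4 by apply: ler_wpM2l.
have dd : cnorm k * (d * d) <= cnorm k / 16.
  rewrite mulrA; apply: le_trans (ler_wpM2r d0 kd) _; lra.
by lra.
Qed.

(** [z] is the inverse square root of [1 - h], equal to 1 plus the limit of the iterates of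
    [invsqrt_step h] from 0. The iterates stay in the ball of radius [cnorm h], which bounds
    [z - 1]. *)
Theorem inverse_square_root h : star h = h -> cnorm h <= 4^-1 ->
  exists z, [/\ star z = z, z * (1 - h) * z = 1, cnorm (z - 1) <= cnorm h
             & forall S, closed_subalg S -> S h -> S z].
Proof.
move=> sh h4; pose u n := iter n (invsqrt_step h) 0.
have d0 := cnorm_ge0 h.
have ub n : cnorm (u n) <= cnorm h.
  by elim: n => [|n IH]; [rewrite cnorm0 | apply: invsqrt_step_bound].
have [|n|l ul] := @contraction_limit R X u 1 (9 / 16).
- by apply/andP; split; lra.
- rewrite mul1r; elim: n => [|n IH].
    rewrite expr0; have := cnormB_le (u 1%N) (u 0%N).
    by have := ub 1%N; have := ub 0%N; lra.
  apply: le_trans (invsqrt_step_lip h4 (ub n.+1) (ub n)) _.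
  by rewrite exprS ler_wpM2l //; lra.
have lS S : closed_subalg S -> S h -> S l.
  move=> hS Sh; apply: (csub_closed hS) => e /ul[N uN]; exists (u N).
    elim: {uN}N => [|n IH]; last exact: invsqrt_step_closed.
    by rewrite /= -(scale0r 1); apply: (csubZ hS); apply: csub1.
  by rewrite cnorm_distC; apply: uN.
have sl : star l = l.
  apply/eqP; rewrite -subr_eq0; apply/eqP/cnorm_eq_small => e e0.
  have [N /(_ N (leqnn N)) uN] := ul (e / 2) (divr_gt0 e0 (ltr0n R 2)).
  have su : star (u N) = u N.
    by elim: {uN}N => [|n IH]; [rewrite star0 | apply: star_invsqrt_step].
  apply: le_lt_trans (cnorm_dist_trans (u N) _ _) _.
  by rewrite -{1}su -starB cnorm_starE (cnorm_distC l); lra.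
have lh : cnorm l <= cnorm h.
  apply/ler_addgt0Pr => e e0; have [N /(_ N (leqnn N)) uN] := ul e e0.
  have := cnorm_le_dist l (u N); rewrite cnorm_distC.
  by have := ub N; lra.
have fl : invsqrt_step h l = l.
  apply/eqP; rewrite -subr_eq0; apply/eqP/cnorm_eq_small => e e0.
  have [N uN] := ul (e / 2) (divr_gt0 e0 (ltr0n R 2)).
  have := uN N (leqnn N); have := uN N.+1 (leqnSn N).
  have := cnorm_dist_trans (u N.+1) (invsqrt_step h l) l.
  have := invsqrt_step_lip h4 lh (ub N); rewrite (cnorm_distC l).
  have := cnorm_ge0 (u N - l); rewrite {2 3}/u /= -/(u N); lra.
exists (1 + l); split.
- by rewrite starD star1 sl.
- have := half_double (h + l * h + h * l - l * l + l * h * l).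
  rewrite -/(invsqrt_step h l) fl => e.
  have -> : (1 + l) * (1 - h) * (1 + l) =
    1 + (l + l) - (h + l * h + h * l - l * l + l * h * l) by ncring.
  by rewrite e addrK.
- by rewrite addrC addKr.
- by move=> S hS Sh; apply: (csubD hS); [apply: csub1 | apply: lS].
Qed.

End InverseSquareRoot.

(** * Star morphisms and projections *)

Section Contractive.
Variable R : realType.

Lemma cnormZR (X : cstarAlgType R) (a : R) (x : X) :
  cnorm (a%:C%C *: x) = `|a| * cnorm x.
Proof. by rewrite cnormZr /= expr0n /= addr0 sqrtr_sqr. Qed.

Lemma starZR (X : cstarAlgType R) (a : R) (x : X) :
  star (a%:C%C *: x) = a%:C%C *: star x.
Proof. by rewrite starZ; congr (_ *: _); apply: conjc_real. Qed.

Variables (A D : cstarAlgType R) (f : {lrmorphism A -> D}).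
Hypothesis fstar : star_preserving f.

(* A self-adjoint [h] of norm at most 1/2 is the real part of the unitary
   [h + i sqrt (1 - h^2)], and unitaries are mapped to unitaries. *)
Lemma star_morph_norm_le1 (h : A) : star h = h -> cnorm h <= 2^-1 ->
  cnorm (f h) <= 1.
Proof.
move=> sh h2; have hh4 : cnorm (h * h) <= 4^-1.
  by have := cnormM_le_of h2 h2; lra.
have shh : star (h * h) = h * h by rewrite starM sh.
have [z [sz zz _ zS]] := inverse_square_root shh hh4.
have hz : h * z = z * h.
  by apply: (zS _ (commutant_closed_subalg h)); rewrite mulrA.
have hhz : h * h * z = z * (h * h) by rewrite -mulrA hz mulrA hz -mulrA.
(* The square root of [1 - h * h], with inverse [z]. *)
pose s := (1 - h * h) * z.
have ss : s * s = 1 - h * h by rewrite /s -mulrA (mulrA z) zz mulr1.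
have sts : star s = s.
  by rewrite /s starM sz starB star1 shh mulrBr mulrBl mul1r mulr1 hhz.
have hs : h * s = s * h.
  have e : h * (1 - h * h) = (1 - h * h) * h by ncring.
  by rewrite /s mulrA e -!mulrA hz.
pose u := h + 'i *: s.
have su : star u = h - 'i *: s by rewrite starD starZ conjCi sh sts scaleNr.
have uu : star u * u = 1.
  rewrite su /u mulrDr !mulrBl -!scalerAl -!scalerAr hs scalerA -(expr2 'i) sqrCi ss.
  by rewrite scaleN1r; ncring.
have fu : cnorm (f u) = 1.
  by apply: cnorm_unitary; rewrite -fstar -rmorphM uu rmorph1.
have -> : h = 2^-1 *: (u + star u).
  by rewrite su /u addrACA subrr addr0 scalerDr half_double.
rewrite linearZ /= cnorm_half rmorphD /= fstar.
by have := cnormD_le (f u) (star (f u)); rewrite cnorm_starE fu; lra.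
Qed.

Lemma star_morph_norm_le2 (h : A) : star h = h -> cnorm (f h) <= 2 * cnorm h.
Proof.
move=> sh; have [->|h0] := eqVneq h 0; first by rewrite raddf0 !cnorm0 mulr0.
have nh0 : 0 < cnorm h.
  by rewrite lt_neqAle cnorm_ge0 andbT eq_sym; apply: contra_neq h0 => /cnorm_eq0.
pose a := (2 * cnorm h)^-1; have a0 : 0 < a by rewrite invr_gt0 mulr_gt0.
have := @star_morph_norm_le1 (a%:C%C *: h); rewrite starZR sh linearZ /= !cnormZR.
rewrite (ger0_norm (ltW a0)).
have ah : a * (2 * cnorm h) = 1 by rewrite mulVf // gt_eqF // mulr_gt0.
move=> /(_ erefl); have -> : a * cnorm h <= 2^-1 by lra.
by move=> /(_ isT) fh; rewrite -(ler_pM2l a0) ah.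
Qed.

(** The factor 2 of [star_morph_norm_le2] is lost by applying that bound to the powers of
    [star x * x] of exponent 2^k. *)
Theorem star_morph_contractive (x : A) : cnorm (f x) <= cnorm x.
Proof.
rewrite -(@ler_pXn2r _ 2) ?nnegrE ?cnorm_ge0 // -!cnorm_star -fstar -rmorphM.
set h := star x * x; have sh : star h = h by rewrite starM starK.
apply: (@le_of_exp2n_le _ _ _ 2) => [||k]; rewrite ?cnorm_ge0 //.
rewrite -!cnorm_exp2n -?fstar ?sh // -rmorphXn.
by apply: star_morph_norm_le2; rewrite star_exp sh.
Qed.

End Contractive.

Section Projections.
Variables (R : realType) (X : cstarAlgType R).
Implicit Types p q x y f : X.

Definition is_proj p := p * p = p /\ star p = p.

Lemma proj_norm_le1 p : is_proj p -> cnorm p <= 1.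
Proof.
case=> pp sp; have := cnorm_sqr sp; rewrite pp expr2 => e.
rewrite leNgt; apply/negP => p1; have := cnorm_ge0 p; nra.
Qed.

Lemma proj_small p : is_proj p -> cnorm p < 1 -> p = 0.
Proof.
case=> pp sp p1; apply: cnorm_eq0; have := cnorm_sqr sp; rewrite pp expr2.
by have := cnorm_ge0 p; nra.
Qed.

Lemma proj_compl p : is_proj p -> is_proj (1 - p).
Proof.
case=> pp sp; split; last by rewrite starB star1 sp.
by rewrite mulrBl !mulrBr !mul1r mulr1 pp subrr subr0.
Qed.

(** [q - p] is itself a projection, and a projection of norm below 1 vanishes. This turns
    approximate equalities of ranges into exact ones. *)
Lemma proj_eq_of_close p q : is_proj p -> is_proj q -> q * p = p ->
  cnorm (q - p) < 1 -> p = q.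
Proof.
move=> [pp sp] [qq sq] qp qp1; apply/esym/eqP; rewrite -subr_eq0; apply/eqP.
have pq : p * q = p by rewrite -sp -sq -starM qp.
apply: proj_small qp1; split; last by rewrite starB sp sq.
by rewrite mulrBl !mulrBr qq qp pq pp subrr subr0.
Qed.

Lemma isometry_proj p f : is_proj p -> star f * f = p -> f * p = f.
Proof.
move=> [pp sp] ff; apply/eqP; rewrite -subr_eq0 -oppr_eq0; apply/eqP/cnorm_eq0.
apply/eqP; rewrite -sqrf_eq0 -cnorm_star opprB starB starM sp.
have -> : (star f - p * star f) * (f - f * p) =
  star f * f - star f * f * p - p * (star f * f) + p * (star f * f) * p by ncring.
by rewrite ff !pp subrr sub0r addNr cnorm0.
Qed.

Lemma isometry_norm_le1 p f : is_proj p -> star f * f = p -> cnorm f <= 1.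
Proof.
move=> hp ff; rewrite -(@ler_pXn2r _ 2) ?nnegrE ?cnorm_ge0 // -cnorm_star ff.
by rewrite expr1n; exact: proj_norm_le1.
Qed.

Lemma isometry_range_proj p f : is_proj p -> star f * f = p ->
  is_proj (f * star f).
Proof.
move=> hp ff; split; last by rewrite starM starK.
by rewrite mulrA -(mulrA f) ff (isometry_proj hp ff).
Qed.

(** [p] is [(1 + s) / 2], where [s] is the sign of [w = 2 x - 1]: since [w * w = 1 - h] with
    [h = 4 (x - x * x)], it is [w] times the inverse square root of [1 - h]. The bound 16^-1 gives
    [cnorm h <= 4^-1], and 10 is half of 5 (for [w]) times 4 (for [h]). *)
Theorem near_projection x : star x = x -> cnorm (x * x - x) <= 16^-1 ->
  exists p, [/\ is_proj p, cnorm (p - x) <= 10 * cnorm (x * x - x)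
             & forall S, closed_subalg S -> S x -> S p].
Proof.
move=> sx; rewrite cnorm_distC; set e := x - x * x => e16.
have se : star e = e by rewrite starB starM sx.
pose h := e + e + (e + e).
have sh : star h = h by rewrite (starD (e + e)) (starD e) se.
have hn : cnorm h <= 4 * cnorm e.
  by have := cnormD_le (e + e) (e + e); have := cnormD_le e e; rewrite /h; lra.
have h4 : cnorm h <= 4^-1 by lra.
have [z [sz zz z1 zS]] := inverse_square_root sh h4.
have xz : x * z = z * x.
  by apply: (zS _ (commutant_closed_subalg x)); rewrite /h /e; ncring.
pose w := x + x - 1; pose s := w * z.
have wz : w * z = z * w by rewrite /w mulrBl mulrBr mulrDl mulrDr xz mul1r mulr1.
have ww : w * w = 1 - h by rewrite /w /h /e; ncring.
have ss : s * s = 1 by rewrite /s {1}wz -mulrA (mulrA w) ww mulrA.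
have sts : star s = s by rewrite /s starM sz wz /w starB starD star1 sx.
have pE : 2^-1 *: (1 + s) - x = 2^-1 *: (w * (z - 1)).
  rewrite -{1}(half_double x) -scalerDr -scalerBr; congr (_ *: _).
  by rewrite mulrBr mulr1 -/s /w opprB addrA addrAC addrC addrA.
have x2 : cnorm x <= 2.
  have := cnorm_sqr sx; rewrite expr2; have := cnorm_le_dist (x * x) x.
  by rewrite cnorm_distC -/e => h1 h2; have := cnorm_ge0 x; nra.
exists (2^-1 *: (1 + s)); split.
- split; last by rewrite star_half starD star1 sts.
  rewrite -scalerAl -scalerAr; congr (_ *: _).
  have -> : (1 + s) * (1 + s) = (1 + s) + (1 + s) + (s * s - 1) by ncring.
  by rewrite ss subrr addr0 scalerDr half_double.
- rewrite pE cnorm_half; have w5 : cnorm w <= 5.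
    by have := cnormB_le (x + x) 1; have := cnormD_le x x; rewrite cnorm1 -/w; lra.
  by have := cnormM_le_of w5 (le_trans z1 hn); lra.
move=> S hS Sx; have Se : S e by apply: (csubB hS) => //; apply: (csubM hS).
have Sh : S h by do 2?apply: (csubD hS).
apply/(csubZ hS)/(csubD hS); first exact: csub1.
by apply: (csubM hS); [apply: (csubB hS); [apply: (csubD hS)|exact: csub1] | apply: zS].
Qed.

(** Remove from [x] its part under [q], then divide by the absolute value: [star y * y = p - h] with
    [h] in the corner of [p], so [y] times the inverse square root of [1 - h] has source exactly
    [p]. The constant 5 counts [2 * (2 * d)] for the normalisation and [d] for [q * x]. *)
Theorem gs_step p q x (d : R) : is_proj p -> is_proj q -> x * p = x ->
  cnorm (star x * x - p) <= d -> cnorm (q * x) <= d -> d <= 8^-1 ->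
  exists f, [/\ star f * f = p, q * f = 0, cnorm (f - x) <= 5 * d
    & forall S, closed_subalg S -> S p -> S q -> S x -> S (star x) -> S f].
Proof.
move=> hp hq xp; rewrite cnorm_distC => xx qx d8.
have [[pp sp] [qq sq]] := (hp, hq).
have px : p * star x = star x by rewrite -{1}sp -starM xp.
pose y := (1 - q) * x; pose h := p - star y * y.
have sy : star y = star x * (1 - q) by rewrite starM starB star1 sq.
have yp : y * p = y by rewrite /y -mulrA xp.
have pty : p * star y = star y by rewrite -{1}sp -starM yp.
have qy : q * y = 0 by rewrite /y mulrA mulrBr mulr1 qq subrr mul0r.
have sh : star h = h by rewrite starB sp starM starK.
have d0 : 0 <= d by apply: le_trans qx; apply: cnorm_ge0.
have hE : h = (p - star x * x) + star (q * x) * (q * x).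
  rewrite /h sy /y mulrA -(mulrA (star x)) (proj1 (proj_compl hq)) starM sq.
  by rewrite mulrA -(mulrA (star x) q q) qq; ncring.
have hn : cnorm h <= 2 * d.
  rewrite hE; apply: le_trans (cnormD_le _ _) _; rewrite cnorm_star expr2.
  by have := cnorm_ge0 (q * x); nra.
have h4 : cnorm h <= 4^-1 by lra.
have [z [sz zz z1 zS]] := inverse_square_root sh h4.
have ph : p * h = h by rewrite /h mulrBr pp mulrA pty.
have hp' : h * p = h by rewrite /h mulrBl pp -mulrA yp.
have pz : p * z = z * p.
  by apply: (zS _ (commutant_closed_subalg p)); rewrite ph hp'.
have y2 : cnorm y <= 2.
  rewrite -(@ler_pXn2r _ 2) ?nnegrE ?cnorm_ge0 // -cnorm_star.
  have -> : star y * y = p - h by rewrite /h opprB addrC subrK.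
  by apply: le_trans (cnormB_le _ _) _; have := proj_norm_le1 hp; rewrite expr2; lra.
exists (y * z); split.
- rewrite starM sz mulrA -(mulrA z).
  have -> : star y * y = p * (1 - h).
    by rewrite mulrBr mulr1 ph /h opprB addrC subrK.
  by rewrite mulrA -pz -(mulrA p) -mulrA zz mulr1.
- by rewrite mulrA qy mul0r.
- have -> : y * z - x = y * (z - 1) - q * x by rewrite /y; ncring.
  by apply: le_trans (cnormB_le _ _) _; have := cnormM_le_of y2 (le_trans z1 hn); lra.
move=> S hS Sp Sq Sx Ssx; have [S1 SM] := (csub1 hS, csubM hS).
have S1q : S (1 - q) by apply: (csubB hS).
have Sy : S y by apply: (SM).
apply: (SM) => //; apply: zS => //; apply: (csubB hS) => //.
by rewrite sy; apply: (SM) => //; apply: (SM).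
Qed.

(** The Gram-Schmidt step for [q * p], kept orthogonal to [1 - q], so that the range of [v] lies
    under [q]; being close to [q], it is [q]. The constant 6 is 5 from that step plus 1 for
    [q * p - p]. *)
Theorem close_projections p q (d : R) : is_proj p -> is_proj q ->
  cnorm (p - q) <= d -> d <= 16^-1 ->
  exists v, [/\ star v * v = p, v * star v = q & cnorm (v - p) <= 6 * d].
Proof.
move=> hp hq pq d16; have [[pp sp] [qq sq]] := (hp, hq).
have [p1 q1] := (proj_norm_le1 hp, proj_norm_le1 hq).
have d0 : 0 <= d by apply: le_trans pq; apply: cnorm_ge0.
have [||||v [vv qv vx _]] := @gs_step p (1 - q) (q * p) d hp (proj_compl hq).
- by rewrite -mulrA pp.
- rewrite starM sp sq mulrA -(mulrA p) qq cnorm_distC.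
  have -> : p - p * q * p = p * (p - q) * p by rewrite mulrBr mulrBl !pp.
  by have := cnormM_le_of (cnormM_le_of p1 pq) p1; rewrite mul1r mulr1.
- by rewrite mulrA mulrBl qq mul1r subrr mul0r cnorm0.
- by lra.
have qv' : q * v = v.
  by move/eqP: qv; rewrite mulrBl mul1r subr_eq0 => /eqP.
exists v; split=> //.
  apply: proj_eq_of_close (isometry_range_proj hp vv) hq _ _.
    by rewrite mulrA qv'.
  have v1 := isometry_norm_le1 hp vv.
  have := cnorm_dist_trans (q * p * (p * q)) q (v * star v).
  have := cnormM_dist_le (q * p) (p * q) v (star v).
  have -> : p * q - star v = star (q * p - v) by rewrite starB starM sp sq.
  rewrite cnorm_starE (cnorm_distC _ v).
  have -> : q - q * p * (p * q) = q * (q - p) * q.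
    by rewrite mulrA -(mulrA q p p) pp mulrBr mulrBl !qq.
  have := cnormM_le_of p1 q1; rewrite (cnorm_distC p) in pq.
  have := cnormM_le_of (cnormM_le_of q1 pq) q1.
  set a := cnorm (v - q * p) in vx *; have := cnorm_ge0 (v - q * p).
  have := cnorm_ge0 v; have := cnorm_ge0 (p * q); rewrite -/a.
  set b := cnorm (p * q); set c := cnorm v in v1 *; nra.
have := cnorm_dist_trans (q * p) v p.
have -> : q * p - p = (q - p) * p by rewrite mulrBl pp.
rewrite (cnorm_distC p) in pq.
by have := cnormM_le_of pq p1; lra.
Qed.

End Projections.

(** * Systems of matrix units *)

Section MatrixUnits.
Variable K : numClosedFieldType.

Record is_mu (X : starAlgType K) (I : finType) (E : I -> I -> X) : Prop := IsMu {
  muM : forall i j k l, E i j * E k l = if j == k then E i l else 0;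
  mu_star : forall i j, star (E i j) = E j i;
  mu_sum1 : \sum_i E i i = 1 }.

Definition mxev (X : starAlgType K) n (E : 'I_n -> 'I_n -> X) (y : 'M[K]_n) : X :=
  \sum_i \sum_j y i j *: E i j.

Section Evaluation.
Variables (X : starAlgType K) (n : nat) (E : 'I_n -> 'I_n -> X).
Implicit Types y z : 'M[K]_n.

Lemma mxevD y z : mxev E (y + z) = mxev E y + mxev E z.
Proof.
rewrite /mxev -big_split; apply: eq_bigr => i _; rewrite -big_split.
by apply: eq_bigr => j _; rewrite mxE scalerDl.
Qed.

Lemma mxevZ (a : K) y : mxev E (a *: y) = a *: mxev E y.
Proof.
rewrite /mxev scaler_sumr; apply: eq_bigr => i _; rewrite scaler_sumr.
by apply: eq_bigr => j _; rewrite mxE scalerA.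
Qed.

Lemma mxev0 : mxev E 0 = 0.
Proof. by rewrite -(scale0r 0) mxevZ scale0r. Qed.

Lemma mxev_sum I (r : seq I) (P : pred I) (F : I -> 'M[K]_n) :
  mxev E (\sum_(i <- r | P i) F i) = \sum_(i <- r | P i) mxev E (F i).
Proof. exact: (big_morph _ mxevD mxev0). Qed.

Lemma mxev_delta i j : mxev E (delta_mx i j) = E i j.
Proof.
rewrite /mxev (bigD1 i) //= (bigD1 j) //= mxE !eqxx scale1r !big1 ?addr0 //.
  by move=> k /negPf ki; rewrite big1 // => l _; rewrite mxE ki scale0r.
by move=> l /negPf lj; rewrite mxE lj andbF scale0r.
Qed.

Hypothesis hE : is_mu E.

Lemma mxevM y z : mxev E (y *m z) = mxev E y * mxev E z.
Proof.
rewrite /mxev mulr_suml; apply: eq_bigr => i _; rewrite mulr_suml.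
rewrite (eq_bigr (fun l => \sum_j y i j * z j l *: E i l)); last first.
  by move=> l _; rewrite mxE scaler_suml.
rewrite exchange_big; apply: eq_bigr => j _; rewrite [RHS]mulr_sumr [RHS](bigD1 j) //=.
rewrite [X in _ = _ + X]big1 ?addr0; last first.
  move=> k /negPf kj; rewrite mulr_sumr big1 // => l _.
  by rewrite -scalerAl -scalerAr (muM hE) eq_sym kj !scaler0.
rewrite mulr_sumr; apply: eq_bigr => l _.
by rewrite -scalerAl -scalerAr (muM hE) eqxx scalerA.
Qed.

Lemma mxev1 : mxev E 1%:M = 1.
Proof.
rewrite -(mu_sum1 hE) /mxev; apply: eq_bigr => i _.
rewrite (bigD1 i) //= mxE eqxx scale1r big1 ?addr0 // => j /negPf ji.
by rewrite mxE eq_sym ji scale0r.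
Qed.

Lemma mxev_star y : mxev E (map_mx Num.conj y^T) = star (mxev E y).
Proof.
rewrite /mxev star_sum exchange_big; apply: eq_bigr => i _.
by rewrite star_sum; apply: eq_bigr => j _; rewrite starZ (mu_star hE) !mxE.
Qed.

(** Isolating one coefficient is the source of injectivity, of the coefficient bound in the norm
    comparison and of the closedness of the range. *)
Lemma mxev_coef y i j k : E k i * mxev E y * E j k = y i j *: E k k.
Proof.
rewrite -!mxev_delta -!mxevM -mxevZ; congr mxev.
apply/matrixP => a b; rewrite !mxE (bigD1 j) //= big1 ?addr0; last first.
  by move=> l /negPf lj; rewrite [X in _ * X]mxE lj mulr0.
rewrite mxE (bigD1 i) //= big1 ?addr0; last first.
  by move=> l /negPf li; rewrite mxE li andbF mul0r.
rewrite !mxE !eqxx andbT /= (mulrC (a == k)%:R) -mulrA; congr (_ * _).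
by case: (a == k); case: (b == k); rewrite ?mulr1 ?mulr0.
Qed.

Lemma mu_neq0 k : E k k != 0.
Proof.
apply/eqP => E0; have := oner_neq0 X; rewrite -(mu_sum1 hE) big1 ?eqxx // => i _.
have := muM hE i k k i; rewrite eqxx => <-.
by have := muM hE i k k k; rewrite eqxx => <-; rewrite E0 mulr0 mul0r.
Qed.

Lemma mxev_inj : injective (mxev E).
Proof.
move=> y z yz; apply/matrixP => i j.
have := mxev_coef y i j i; rewrite yz mxev_coef => /eqP.
rewrite -subr_eq0 -scalerBl scaler_eq0 (negPf (mu_neq0 i)) orbF subr_eq0.
by move/eqP.
Qed.

Lemma mu_decomp k x :
  x = \sum_i \sum_j E i k * (E k i * x * E j k) * E k j.
Proof.
rewrite -{1}[x]mul1r -{1}[x]mulr1 -(mu_sum1 hE) mulr_suml.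
apply: eq_bigr => i _; rewrite !mulr_sumr; apply: eq_bigr => j _.
have := muM hE i k k i; have := muM hE j k k j; rewrite !eqxx => <- <-.
by rewrite !mulrA.
Qed.

End Evaluation.

Lemma eq_mxev (X : starAlgType K) n (E F : 'I_n -> 'I_n -> X) :
  (forall i j, E i j = F i j) -> mxev E =1 mxev F.
Proof.
by move=> EF y; apply: eq_bigr => i _; apply: eq_bigr => j _; rewrite EF.
Qed.

Lemma mxev_morph (X Y : starAlgType K) (f : {lrmorphism X -> Y}) n
  (E : 'I_n -> 'I_n -> X) y : f (mxev E y) = mxev (fun i j => f (E i j)) y.
Proof.
rewrite /mxev linear_sum; apply: eq_bigr => i _; rewrite linear_sum.
by apply: eq_bigr => j _; rewrite linearZ.
Qed.

Lemma mu_morph (X Y : starAlgType K) (f : {lrmorphism X -> Y}) (I : finType)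
  (E : I -> I -> X) : star_preserving f -> is_mu E ->
  is_mu (fun i j => f (E i j)).
Proof.
move=> fs hE; split=> [i j k l|i j|].
- by rewrite -rmorphM (muM hE); case: eqP => // _; rewrite raddf0.
- by rewrite -fs (mu_star hE).
by rewrite -linear_sum (mu_sum1 hE) /= rmorph1.
Qed.

Lemma mxev_mxev (X : starAlgType K) m n (F : 'I_m.+1 -> 'I_m.+1 -> X)
    (T : 'I_n -> 'I_n -> 'M[K]_m.+1) y :
  mxev (fun i j => mxev F (T i j)) y = mxev F (mxev T y).
Proof.
rewrite [mxev T y]/mxev mxev_sum; apply: eq_bigr => i _; rewrite mxev_sum.
by apply: eq_bigr => j _; rewrite mxevZ.
Qed.

(** The converse direction holds because [mxev F] is injective. It pulls a system lying in the range
    of [F] back to matrices, where traces and ranks are available. *)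
Lemma mu_mxev (X : starAlgType K) m (I : finType) (F : 'I_m.+1 -> 'I_m.+1 -> X)
    (T : I -> I -> 'M[K]_m.+1) : is_mu F ->
  is_mu T <-> is_mu (fun i j => mxev F (T i j)).
Proof.
move=> hF; split=> hT; split=> [i j k l|i j|].
- by rewrite -mxevM // [_ *m _](muM hT); case: eqP => // _; rewrite mxev0.
- by rewrite -mxev_star // -(mu_star hT i j).
- by rewrite -mxev_sum (mu_sum1 hT) [LHS]mxev1.
- apply: (mxev_inj hF); rewrite [LHS]mxevM // (muM hT).
  by case: eqP => // _; rewrite mxev0.
- by apply: (mxev_inj hF); rewrite [LHS]mxev_star // (mu_star hT).
by apply: (mxev_inj hF); rewrite mxev_sum (mu_sum1 hT) [RHS]mxev1.
Qed.

Lemma mu_delta n : is_mu (fun i j : 'I_n.+1 => delta_mx i j : 'M[K]_n.+1).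
Proof.
split=> [i j k l|i j|].
- rewrite [LHS]mul_delta_mx_cond; case: eqP => _ //=; by rewrite ?mulr1n ?mulr0n.
- apply/matrixP => a b; rewrite !mxE andbC.
  by case: (_ && _) => /=; rewrite ?rmorph1 ?rmorph0.
by rewrite [RHS]mx1_sum_delta.
Qed.

Lemma mu_conj (X : starAlgType K) (I : finType) (E : I -> I -> X) (w : X) :
  star w * w = 1 -> w * star w = 1 -> is_mu E ->
  is_mu (fun i j => w * E i j * star w).
Proof.
move=> w1 w2 hE; split=> [i j k l|i j|].
- have -> : w * E i j * star w * (w * E k l * star w) =
    w * (E i j * ((star w * w) * E k l)) * star w by rewrite !mulrA.
  by rewrite w1 mul1r (muM hE); case: eqP; rewrite ?mulr0 ?mul0r.
- by rewrite !starM starK (mu_star hE) mulrA.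
by rewrite -mulr_suml -mulr_sumr (mu_sum1 hE) mulr1.
Qed.

(** One partial isometry from [E k k] to [F k k] is transported to all diagonal units by the two
    systems, and the pieces add up to a unitary. *)
Lemma mu_intertwiner (X : starAlgType K) (I : finType) (E F : I -> I -> X)
    (k : I) (v : X) : is_mu E -> is_mu F ->
  star v * v = E k k -> v * star v = F k k -> v * E k k = v ->
  let w := \sum_i F i k * v * E k i in
  [/\ star w * w = 1, w * star w = 1 & forall i j, w * E i j * star w = F i j].
Proof.
move=> hE hF vv vv' vE w; have Ev : E k k * star v = star v.
  by rewrite -{2}vE starM (mu_star hE).
have sw : star w = \sum_i E i k * star v * F k i.
  rewrite star_sum; apply: eq_bigr => i _.
  by rewrite !starM (mu_star hE) (mu_star hF) mulrA.
have wE i j : w * E i j = F i k * v * E k j.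
  rewrite mulr_suml (bigD1 i) //= -mulrA (muM hE) eqxx big1 ?addr0 // => l li.
  by rewrite -mulrA (muM hE) (negPf li) mulr0.
have wEw i j : w * E i j * star w = F i j.
  rewrite wE sw mulr_sumr (bigD1 j) //= big1 ?addr0 => [|l lj].
    rewrite !mulrA -(mulrA _ (E k j)) (muM hE) eqxx -(mulrA _ (E k k)) Ev.
    by rewrite -(mulrA _ v) vv' (muM hF) eqxx (muM hF) eqxx.
  by rewrite !mulrA -(mulrA _ (E k j)) (muM hE) eq_sym (negPf lj) mulr0 !mul0r.
split=> //.
  rewrite sw mulr_suml -(mu_sum1 hE); apply: eq_bigr => i _.
  rewrite mulr_sumr (bigD1 i) //= big1 ?addr0 => [|l li].
    rewrite !mulrA -(mulrA _ (F k i)) (muM hF) eqxx -vv'.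
    have -> : E i k * star v * (v * star v) * v * E k i =
      E i k * ((star v * v) * (star v * v)) * E k i by rewrite !mulrA.
    by rewrite vv !(muM hE, eqxx).
  by rewrite !mulrA -(mulrA _ (F k i)) (muM hF) eq_sym (negPf li) mulr0 !mul0r.
rewrite -{1}[w]mulr1 -{1}(mu_sum1 hE) -(mu_sum1 hF) mulr_sumr mulr_suml.
by apply: eq_bigr.
Qed.

End MatrixUnits.

(** * Gram-Schmidt orthonormalisation of partial isometries *)

Section GramSchmidt.
Variables (R : realType) (X : cstarAlgType R).
Implicit Types p q : X.

Definition ortho_isometries (I : eqType) (s : seq I) p (f : I -> X) :=
  {in s &, forall i j, star (f i) * f j = if i == j then p else 0}.

Section Range.
Variables (I : eqType) (s : seq I) (p : X) (f : I -> X).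
Hypotheses (us : uniq s) (hp : is_proj p) (fs : ortho_isometries s p f).

Lemma ortho_isometries_source j : j \in s -> f j * p = f j.
Proof. by move=> js; apply: isometry_proj => //; rewrite fs // eqxx. Qed.

Lemma ortho_isometries_range j : j \in s ->
  (\sum_(k <- s) f k * star (f k)) * f j = f j.
Proof.
move=> js; rewrite mulr_suml (bigD1_seq j) //= -mulrA fs // eqxx.
rewrite ortho_isometries_source // big_seq_cond big1 ?addr0 // => k /andP[ks kj].
by rewrite -mulrA fs // (negPf kj) mulr0.
Qed.

Lemma ortho_isometries_range_proj : is_proj (\sum_(k <- s) f k * star (f k)).
Proof.
split; last by rewrite star_sum; apply: eq_bigr => i _; rewrite starM starK.
rewrite mulr_sumr big_seq [RHS]big_seq; apply: eq_bigr => j js.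
by rewrite mulrA ortho_isometries_range.
Qed.

End Range.

(** The tolerance [d] is fixed before [p], [S] and [x]. In the induction the new element is made
    orthogonal to [q], the sum of the range projections already built. *)
Theorem gram_schmidt (I : eqType) (s : seq I) : uniq s ->
  forall e : R, 0 < e -> exists2 d : R, 0 < d &
  forall p (S : X -> Prop) (x : I -> X), is_proj p -> closed_subalg S ->
    (forall y, S y -> S (star y)) -> S p ->
    {in s, forall i, S (x i) /\ x i * p = x i} ->
    {in s &, forall i j,
      cnorm (star (x i) * x j - (if i == j then p else 0)) <= d} ->
  exists2 f : I -> X, ortho_isometries s p f &
    {in s, forall i, S (f i) /\ cnorm (f i - x i) <= e}.
Proof.
elim: s => [|i s IH] /=; first by move=> _ e e0; exists 1 => // p S x *; exists x.
move=> /andP[nis us] e e0.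
pose n : R := (size s)%:R; have n0 : 0 <= n := ler0n _ _.
have [d1 [d10 d18 d1e]] : exists d1 : R, [/\ 0 < d1, d1 <= 8^-1 & d1 <= e / 5].
  exists (Num.min 8^-1 (e / 5)).
  by rewrite lt_min invr_gt0 ltr0n divr_gt0 // !ge_min !lexx orbT.
(* Each of the [n] summands of [q * x i] has norm at most [2 * e' + d <= 3 * c], so [q * x i] stays
   below the tolerance [d1] of [gs_step]. *)
pose c := d1 / (4 * (n + 1)).
have c0 : 0 < c by rewrite divr_gt0 //; lra.
have cE : c * (4 * (n + 1)) = d1 by rewrite divfK // gt_eqF //; lra.
have [e' [e'0 e'e e'c]] : exists e', [/\ 0 < e', e' <= e & e' <= c].
  by exists (Num.min e c); rewrite lt_min e0 c0 !ge_min !lexx orbT.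
have [d' d'0 IHd] := IH us _ e'0.
have [d [d0 dd' dc d1d]] : exists d, [/\ 0 < d, d <= d', d <= c & d <= d1].
  exists (Num.min d' (Num.min c d1)).
  by rewrite !lt_min d'0 c0 d10 !ge_min !lexx !orbT.
exists d => // p S x hp hS Sstar Sp xS xx.
have [|j k js ks|f fs fx] := IHd p S x hp hS Sstar Sp.
- by move=> j js; apply: xS; rewrite inE js orbT.
- by apply: le_trans dd'; apply: xx; rewrite inE ?js ?ks orbT.
pose q := \sum_(k <- s) f k * star (f k).
have hq : is_proj q := ortho_isometries_range_proj us hp fs.
have [Sx xp] := xS i (mem_head _ _).
have xxi := xx i i (mem_head _ _) (mem_head _ _); rewrite eqxx in xxi.
have x2 : cnorm (x i) <= 2.
  rewrite -(@ler_pXn2r _ 2) ?nnegrE ?cnorm_ge0 // -cnorm_star.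
  have := cnorm_le_dist (star (x i) * x i) p; have := proj_norm_le1 hp.
  by rewrite expr2; lra.
have qx : cnorm (q * x i) <= d1.
  rewrite /q mulr_suml; apply: le_trans (cnorm_sum_le _ _ _) _.
  apply: (@le_trans _ _ (\sum_(j <- s) (3 * c))); last first.
    by rewrite big_const_seq count_predT iter_addr addr0 -mulr_natl -/n; nra.
  rewrite big_seq [leRHS]big_seq; apply: ler_sum => j js.
  have [Sf fxj] := fx j js.
  have fj1 : cnorm (f j) <= 1.
    by apply: isometry_norm_le1 hp _; rewrite fs // eqxx.
  have -> : f j * star (f j) * x i =
    f j * (star (f j - x j) * x i + star (x j) * x i) by rewrite starB; ncring.
  apply: le_trans (cnormM_le_of fj1 (lexx _)) _; rewrite mul1r.
  apply: le_trans (cnormD_le _ _) _.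
  have xxj := xx j i; rewrite inE js orbT mem_head in xxj.
  have {xxj} := xxj isT isT; rewrite ifN ?subr0; last first.
    by apply: contra nis => /eqP <-.
  have := cnormM_le_of (lexx (cnorm (star (f j - x j)))) x2.
  by rewrite cnorm_starE; lra.
have [f0 [f00 qf0 f0x f0S]] :=
  gs_step hp hq xp (le_trans xxi d1d) qx d18.
have ortho j : j \in s -> star (f j) * f0 = 0.
  move=> js; rewrite -(ortho_isometries_range us hp fs js) starM.
  by rewrite (proj2 hq) -mulrA qf0 mulr0.
have ne j : j \in s -> (j == i) = false.
  by move=> js; apply/eqP => ji; rewrite -ji js in nis.
exists (fun j => if j == i then f0 else f j).
  move=> j k; rewrite !inE; case/orP => [/eqP->|js]; case/orP => [/eqP->|ks].
  - by rewrite !eqxx.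
  - rewrite eqxx [k == i]ne // [i == k]eq_sym ne //.
    by rewrite -[star f0 * f k]starK starM starK ortho // star0.
  - by rewrite eqxx ne // ortho.
  - by rewrite !ne // fs.
move=> j; rewrite inE; case/orP => [/eqP->|js]; last first.
  by rewrite ne //; have [Sf fxj] := fx j js; split => //; apply: le_trans fxj e'e.
rewrite eqxx; split; last by lra.
apply: f0S => //; last exact: Sstar.
rewrite /q big_seq; apply: csub_sum => // k /fx[Sf _].
by apply: (csubM hS) => //; apply: Sstar.
Qed.


(** The ranges sum to a projection whose distance to 1 is at most [2^-1 + n * (3 * c)]; the choice
    of [c] makes this less than 1, hence the projection equals 1. *)
Theorem gram_schmidt_unital (I : finType) (e : R) : 0 < e ->
  exists2 d : R, 0 < d &
  forall p (S : X -> Prop) (x : I -> X), is_proj p -> closed_subalg S ->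
    (forall y, S y -> S (star y)) -> S p ->
    (forall i, S (x i)) -> (forall i, x i * p = x i) ->
    (forall i j, cnorm (star (x i) * x j - (if i == j then p else 0)) <= d) ->
    cnorm (\sum_i x i * star (x i) - 1) <= 2^-1 ->
  exists f : I -> X,
    [/\ forall i j, star (f i) * f j = if i == j then p else 0,
        \sum_i f i * star (f i) = 1, forall i, S (f i)
      & forall i, cnorm (f i - x i) <= e].
Proof.
move=> e0; pose n : R := #|I|%:R; have n0 : 0 <= n := ler0n _ _.
pose c := (8 * (n + 1))^-1.
have c0 : 0 < c by rewrite invr_gt0; lra.
have cE : c * (8 * (n + 1)) = 1 by rewrite mulVf // gt_eqF //; lra.
have [e' [e'0 e'e e'c]] : exists e', [/\ 0 < e', e' <= e & e' <= c].
  by exists (Num.min e c); rewrite lt_min e0 c0 !ge_min !lexx orbT.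
have [d d0 gs] := gram_schmidt (enum_uniq I) e'0.
exists d => // p S x hp hS Sstar Sp Sx xp xx x1.
have [i _|i j _ _|f fs fx] := gs p S x hp hS Sstar Sp; [by split|exact: xx|].
have hq := ortho_isometries_range_proj (enum_uniq I) hp fs.
rewrite big_enum /= in hq.
have ff i j : star (f i) * f j = if i == j then p else 0.
  by apply: fs; rewrite mem_enum.
have fx' i : cnorm (f i - x i) <= e' by have [] := fx i; rewrite ?mem_enum.
exists f; split=> //; last 2 first.
- by move=> i; have [] := fx i; rewrite ?mem_enum.
- by move=> i; apply: le_trans (fx' i) e'e.
apply: proj_eq_of_close hq _ _ _; first by split; rewrite ?mulr1 ?star1.
  by rewrite mul1r.
have := cnorm_dist_trans (\sum_i x i * star (x i)) 1 (\sum_i f i * star (f i)).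
rewrite (cnorm_distC 1 (\sum_i x i * _)) => h; apply: le_lt_trans h _.
suff : cnorm (\sum_i x i * star (x i) - \sum_i f i * star (f i)) <= n * (3 * c).
  by lra.
rewrite -sumrB; apply: le_trans (cnorm_sum_le _ _ _) _.
rewrite /n mulr_natl -sumr_const; apply: ler_sum => i _.
have f1 : cnorm (f i) <= 1 by apply: isometry_norm_le1 hp _; rewrite ff eqxx.
have := cnormM_dist_le (x i) (star (x i)) (f i) (star (f i)).
rewrite -starB !cnorm_starE (cnorm_distC (x i)).
have c1 : c <= 8^-1 by have := mulr_ge0 (ltW c0) n0; lra.
have x2 : cnorm (x i) <= 2.
  by have := cnorm_le_dist (x i) (f i); have := fx' i; rewrite cnorm_distC; lra.
have := fx' i; have := cnorm_ge0 (x i); have := cnorm_ge0 (f i - x i).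
set a := cnorm (f i - x i); set b := cnorm (x i) in x2 *; set b' := cnorm (f i) in f1 *.
move=> a0 b0 ae h; apply: le_trans h _; nra.
Qed.

Lemma isometries_mu (I : finType) p (f : I -> X) : is_proj p ->
  (forall i j, star (f i) * f j = if i == j then p else 0) ->
  \sum_i f i * star (f i) = 1 -> is_mu (fun i j => f i * star (f j)).
Proof.
move=> hp ff f1; split=> // [i j k l|i j]; last by rewrite starM starK.
rewrite mulrA -(mulrA (f i)) ff; case: eqP => _; last by rewrite mulr0 mul0r.
by rewrite (isometry_proj hp) // ff eqxx.
Qed.

End GramSchmidt.

(** * Matrix units in matrix algebras *)

Section MatrixProjections.
Variable K : numClosedFieldType.
Import mathcomp.algebra.spectral.

Local Notation "M ^*t" := (map_mx Num.conj M^T) (at level 8, format "M ^*t").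

Lemma ctmx_mul m n p (A : 'M[K]_(m, n)) (B : 'M[K]_(n, p)) :
  (A *m B)^*t = B^*t *m A^*t.
Proof. by rewrite trmx_mul map_mxM. Qed.

Lemma ctmxK m n (A : 'M[K]_(m, n)) : A^*t^*t = A.
Proof. by apply/matrixP => i j; rewrite !mxE conjCK. Qed.

(** Orthonormalise the rows of [q]: [W] has the row space of [q], so [W^*t *m W] is the orthogonal
    projection onto it, which is [q]. *)
Lemma mx_proj_factor m (q : 'M[K]_m) : q *m q = q -> q^*t = q ->
  exists r (V : 'M[K]_(m, r)), V *m V^*t = q /\ V^*t *m V = 1%:M.
Proof.
move=> qq sq; pose W := schmidt (row_base q).
have WW : W *m W^*t = 1%:M by apply/unitarymxP/schmidt_unitarymx/rank_leq_col.
have Wq : (W :=: q)%MS.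
  exact: eqmx_trans (eqmx_schmidt_free (row_base_free q)) (eq_row_base q).
have /submxP[D WD] : (W <= q)%MS by rewrite Wq.
have /submxP[D' qD] : (q <= W)%MS by rewrite Wq.
have qW : q *m (W^*t *m W) = q by rewrite {1}qD mulmxA -(mulmxA D') WW mulmx1 -qD.
have Wq' : W *m q = W by rewrite WD -mulmxA qq.
have e : W^*t *m W = q.
  rewrite -[RHS]sq -[in RHS]qW !ctmx_mul ctmxK sq -mulmxA.
  by rewrite Wq'.
by exists (\rank q), W^*t; rewrite ctmxK; split.
Qed.

(** The diagonal units are equivalent, so all have trace [r], and their sum is the identity. *)
Lemma mu_mx_rank m n r (E : 'I_n -> 'I_n -> 'M[K]_m.+1) k (V : 'M[K]_(m.+1, r)) :
  is_mu E -> V *m V^*t = E k k -> V^*t *m V = 1%:M -> (n * r)%N = m.+1.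
Proof.
move=> hE VV V1; have trE i : \tr (E i i) = r%:R :> K.
  have := muM hE i k k i; rewrite eqxx => <-; rewrite mxtrace_mulC.
  have := muM hE k i i k; rewrite eqxx /GRing.mul /= => ->.
  by rewrite -VV mxtrace_mulC V1 mxtrace1.
have := congr1 mxtrace (mu_sum1 hE); rewrite mxtrace1 linear_sum /=.
rewrite (eq_bigr (fun=> r%:R)) => [|i _]; last exact: trE.
by rewrite sumr_const card_ord -mulrnA mulnC => /eqP; rewrite eqr_nat => /eqP.
Qed.

Lemma mu_mx_diag_factor m n (E : 'I_n -> 'I_n -> 'M[K]_m.+1) k : is_mu E ->
  exists r (V : 'M[K]_(m.+1, r)), V *m V^*t = E k k /\ V^*t *m V = 1%:M.
Proof.
move=> hE; apply: mx_proj_factor; last exact: (mu_star hE k k).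
by have := muM hE k k k k; rewrite eqxx.
Qed.

Lemma mu_mx_dvdn m n (E : 'I_n.+1 -> 'I_n.+1 -> 'M[K]_m.+1) : is_mu E ->
  (n.+1 %| m.+1)%N.
Proof.
move=> hE; have [r [V [VV V1]]] := mu_mx_diag_factor ord0 hE.
by rewrite -(mu_mx_rank hE VV V1) dvdn_mulr.
Qed.

(* Skolem-Noether for systems of matrix units. *)
Lemma mu_mx_conj m n (E F : 'I_n.+1 -> 'I_n.+1 -> 'M[K]_m.+1) :
  is_mu E -> is_mu F -> exists w : 'M[K]_m.+1,
  [/\ star w * w = 1, w * star w = 1 & forall i j, w * E i j * star w = F i j].
Proof.
move=> hE hF; have [r [V [VV V1]]] := mu_mx_diag_factor ord0 hE.
have [r' [W [WW W1]]] := mu_mx_diag_factor ord0 hF.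
(* Both ranks are the quotient of the sizes, so a partial isometry joins the two ranges. *)
have rr' : r = r'.
  apply/eqP; rewrite -(eqn_pmul2l (ltn0Sn n)).
  by rewrite (mu_mx_rank hE VV V1) (mu_mx_rank hF WW W1).
subst r'; pose v : 'M[K]_m.+1 := W *m V^*t.
have sv : star v = V *m W^*t by rewrite /star /= /mxstar ctmx_mul ctmxK.
have [|||w1 w2 wE] := @mu_intertwiner K _ _ E F ord0 v hE hF.
- by rewrite sv [LHS]mulmxA -(mulmxA V) W1 mulmx1.
- by rewrite sv [LHS]mulmxA -(mulmxA W) V1 mulmx1.
- by rewrite -VV [LHS]mulmxA -(mulmxA W) V1 mulmx1.
by exists (\sum_i F i ord0 * v * E ord0 i).
Qed.

Lemma mu_reindex (X : starAlgType K) (I J : finType) (E : I -> I -> X)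
    (f : J -> I) : bijective f -> is_mu E -> is_mu (fun a b => E (f a) (f b)).
Proof.
move=> bf hE; have fI := bij_inj bf; split=> [i j k l|i j|].
- by rewrite (muM hE) (inj_eq fI).
- exact: (mu_star hE).
rewrite -(mu_sum1 hE) [RHS](reindex f) //; exact: onW_bij.
Qed.

(** The unital amplification of the matrices over [I] to those over [I * J]. *)
Lemma mu_block (X : starAlgType K) (I J : finType) (E : I * J -> I * J -> X) :
  is_mu E -> is_mu (fun i j => \sum_c E (i, c) (j, c)).
Proof.
move=> hE; split=> [i j k l|i j|].
- rewrite mulr_suml; case: eqP => [<-|jk]; last first.
    rewrite big1 // => c _; rewrite mulr_sumr big1 // => d _.
    by rewrite (muM hE) xpair_eqE; case: eqP.
  apply: eq_bigr => c _; rewrite mulr_sumr (bigD1 c) //= (muM hE) eqxx.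
  rewrite big1 ?addr0 // => d /negPf dc.
  by rewrite (muM hE) xpair_eqE eqxx eq_sym dc.
- by rewrite star_sum; apply: eq_bigr => c _; rewrite (mu_star hE).
by rewrite pair_bigA /= -(mu_sum1 hE); apply: eq_bigr => -[].
Qed.

Lemma mu_mx_exists m n : (n.+1 %| m.+1)%N ->
  exists E : 'I_n.+1 -> 'I_n.+1 -> 'M[K]_m.+1, is_mu E.
Proof.
case/dvdnP => d md.
have c : #|{: 'I_n.+1 * 'I_d}| = m.+1 by rewrite card_prod !card_ord mulnC.
pose f (x : 'I_n.+1 * 'I_d) : 'I_m.+1 := cast_ord c (enum_rank x).
have bf : bijective f.
  exists (fun i => enum_val (cast_ord (esym c) i)) => x; rewrite /f.
    by rewrite cast_ordK enum_rankK.
  by rewrite enum_valK cast_ordKV.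
have := mu_block (mu_reindex bf (mu_delta K m)).
by exists (fun i j => \sum_c delta_mx (f (i, c)) (f (j, c))).
Qed.

(** The crossed product yields units indexed by [G * 'I_l], while [mxev] takes ordinals. The index
    type is nonempty because the diagonal units sum to 1. *)
Lemma mu_ord (X : starAlgType K) (I : finType) (E : I -> I -> X) : is_mu E ->
  exists m (F : 'I_m.+1 -> 'I_m.+1 -> X), is_mu F /\
    forall i j, exists y, E i j = mxev F y.
Proof.
move=> hE; have /card_gt0P[i0 _] : (0 < #|I|)%N.
  rewrite lt0n; apply/eqP => /card0_eq I0; have := oner_neq0 X.
  by rewrite -(mu_sum1 hE) big_pred0 ?eqxx // => i; have := I0 i; rewrite inE.
have c : #|I|.-1.+1 = #|I| by rewrite prednK //; apply/card_gt0P; exists i0.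
pose f i : I := enum_val (cast_ord c i).
pose g i : 'I_(#|I|.-1.+1) := cast_ord (esym c) (enum_rank i).
have gf i : f (g i) = i by rewrite /f /g cast_ordKV enum_rankK.
have bf : bijective f.
  by exists g => // x; rewrite /f /g enum_valK cast_ordK.
exists #|I|.-1, (fun a b => E (f a) (f b)); split; first exact: mu_reindex.
by move=> i j; exists (delta_mx (g i) (g j)); rewrite mxev_delta !gf.
Qed.

End MatrixProjections.

(** * Norms on matrix subalgebras *)

Section ComplexComplete.
Variable R : realType.

Lemma real_cauchy (u : nat -> R) :
  (forall e : R, 0 < e -> exists N, forall m n,
    (N <= m)%N -> (N <= n)%N -> `|u m - u n| < e) ->
  exists l, forall e : R, 0 < e -> exists N, forall n, (N <= n)%N -> `|u n - l| < e.
Proof.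
move=> ucauchy; have /cvg_ex[l ul] : cvg (u @ \oo).
  apply/cauchy_cvgP/cauchy_exP => e e0; have [N uN] := ucauchy e e0.
  exists (u N); exists N => // n /= Nn; rewrite /ball /=; exact: uN.
exists l => e e0; move/cvgrPdist_lt: ul => /(_ e e0)[N _ uN].
by exists N => n /uN /=; rewrite distrC.
Qed.

Lemma normc_Re_le (a : R[i]) : `|complex.Re a| <= Normc.normc a.
Proof.
case: a => a b /=; rewrite -(sqrtr_sqr a) ler_sqrt ?addr_ge0 ?sqr_ge0 //.
by rewrite lerDl sqr_ge0.
Qed.

Lemma normc_Im_le (a : R[i]) : `|complex.Im a| <= Normc.normc a.
Proof.
case: a => a b /=; rewrite -(sqrtr_sqr b) ler_sqrt ?addr_ge0 ?sqr_ge0 //.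
by rewrite lerDr sqr_ge0.
Qed.

Lemma normc_le_ReIm (a : R[i]) :
  Normc.normc a <= `|complex.Re a| + `|complex.Im a|.
Proof.
case: a => a b /=; rewrite -(@ler_pXn2r _ 2) ?nnegrE ?sqrtr_ge0 ?addr_ge0 //.
rewrite sqr_sqrtr ?addr_ge0 ?sqr_ge0 // sqrrD !real_normK ?num_real //.
by rewrite (addrAC (a ^+ 2) (_ *+ 2)) lerDl mulrn_wge0 // mulr_ge0.
Qed.

Lemma normc_ge0 (a : R[i]) : 0 <= Normc.normc a.
Proof. by case: a => a b; apply: sqrtr_ge0. Qed.

Lemma complex_cauchy (c : nat -> R[i]) :
  (forall e : R, 0 < e -> exists N, forall m n,
    (N <= m)%N -> (N <= n)%N -> Normc.normc (c m - c n) < e) ->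
  exists l, forall e : R, 0 < e -> exists N, forall n, (N <= n)%N ->
    Normc.normc (c n - l) < e.
Proof.
move=> cc.
have [|a ca] := @real_cauchy (fun n => complex.Re (c n)).
  move=> e /cc[N cN]; exists N => m n Nm Nn; apply: le_lt_trans (cN m n Nm Nn).
  by apply: le_trans (normc_Re_le _); case: (c m) => ? ?; case: (c n) => ? ?.
have [|b cb] := @real_cauchy (fun n => complex.Im (c n)).
  move=> e /cc[N cN]; exists N => m n Nm Nn; apply: le_lt_trans (cN m n Nm Nn).
  by apply: le_trans (normc_Im_le _); case: (c m) => ? ?; case: (c n) => ? ?.
exists (Complex a b) => e e0; have e2 : 0 < e / 2 by rewrite divr_gt0.
have [[N cN] [M cM]] := (ca _ e2, cb _ e2).
exists (maxn N M) => n; rewrite geq_max => /andP[/cN h1 /cM h2].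
apply: le_lt_trans (normc_le_ReIm _) _.
by case: (c n) h1 h2 => x y /=; lra.
Qed.

(** As [e] is nonzero, the coefficients of an approximating sequence are Cauchy, and the complex
    numbers are complete. *)
Lemma closed_line (X : cstarAlgType R) (e : X) : e != 0 ->
  closed_set (fun x => exists a : R[i], x = a *: e).
Proof.
move=> e0 x xe; have ne : 0 < cnorm e.
  by rewrite lt_neqAle cnorm_ge0 andbT eq_sym; apply: contra_neq e0 => /cnorm_eq0.
have h n : exists a : R[i], cnorm (x - a *: e) < n.+1%:R^-1.
  have [|y [a ->]] := xe (n.+1%:R^-1); first by rewrite invr_gt0.
  by exists a.
have {h} [c xc] := choice h.
have small r : 0 < r -> exists N, forall n, (N <= n)%N -> cnorm (x - c n *: e) < r.
  move=> r0; exists (Num.bound r^-1) => n Nn.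
  apply: lt_trans (xc n) _; rewrite -[r]invrK ltf_pV2 ?posrE ?invr_gt0 //.
  apply: lt_le_trans (archi_boundP _) _; first by rewrite invr_ge0 ltW.
  by rewrite ler_nat ltnW.
have [|l cl] := @complex_cauchy c.
  move=> r r0; have [|N xN] := small (r * cnorm e / 2).
    by rewrite divr_gt0 // mulr_gt0.
  exists N => m n /xN xm /xN xn; rewrite -(ltr_pM2r ne) -cnormZr scalerBl.
  apply: le_lt_trans (cnorm_dist_trans x _ _) _; rewrite (cnorm_distC _ x); lra.
exists l; apply/eqP; rewrite -subr_eq0; apply/eqP/cnorm_eq_small => r r0.
have [|N xN] := small (r / 2); first by rewrite divr_gt0.
have [|M cM] := cl (r / 2 / cnorm e); first by rewrite !divr_gt0.
have := xN _ (leq_maxl N M); have := cM _ (leq_maxr N M).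
rewrite ltr_pdivlMr // -cnormZr scalerBl.
set n := maxn N M; have := cnorm_dist_trans (c n *: e) x (l *: e); lra.
Qed.

End ComplexComplete.

Section MatrixUnitsNorm.
Variables (R : realType) (X : cstarAlgType R).

Lemma mu_proj (I : finType) (E : I -> I -> X) i : is_mu E -> is_proj (E i i).
Proof.
by move=> hE; split; [rewrite (muM hE) eqxx | apply: (mu_star hE)].
Qed.

Lemma mu_norm_le1 (I : finType) (E : I -> I -> X) i j : is_mu E ->
  cnorm (E i j) <= 1.
Proof.
move=> hE; apply: isometry_norm_le1 (mu_proj j hE) _.
by rewrite (mu_star hE) (muM hE) eqxx.
Qed.

Definition mx_range n (E : 'I_n -> 'I_n -> X) (x : X) := exists y, x = mxev E y.

Lemma mx_range_star n (E : 'I_n -> 'I_n -> X) x : is_mu E -> mx_range E x ->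
  mx_range E (star x).
Proof. by move=> hE [y ->]; exists (map_mx Num.conj y^T); rewrite mxev_star. Qed.

(** For closedness: each compression [E ord0 i * x * E j ord0] stays on the closed line through
    [E ord0 ord0], and [x] is rebuilt from these by [mu_decomp]. *)
Lemma mx_range_closed_subalg n (E : 'I_n.+1 -> 'I_n.+1 -> X) : is_mu E ->
  closed_subalg (mx_range E).
Proof.
move=> hE; split.
- by exists 1%:M; rewrite mxev1.
- by move=> _ _ [y ->] [z ->]; exists (y + z); rewrite mxevD.
- by move=> a _ [y ->]; exists (a *: y); rewrite mxevZ.
- by move=> _ _ [y ->] [z ->]; exists (y *m z); rewrite mxevM.
move=> x xE; have h i j : exists a : R[i], E ord0 i * x * E j ord0 = a *: E ord0 ord0.
  apply: (closed_line (mu_neq0 hE ord0)) => e e0; have [_ [y ->] xy] := xE e e0.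
  exists (E ord0 i * mxev E y * E j ord0); first by exists (y i j); rewrite mxev_coef.
  rewrite -mulrBl -mulrBr; apply: le_lt_trans xy.
  have E1 a b := mu_norm_le1 a b hE.
  have := cnormM_le_of
    (cnormM_le_of (E1 ord0 i) (lexx (cnorm (x - mxev E y)))) (E1 j ord0).
  by rewrite mul1r mulr1.
have h' i : exists f : 'I_n.+1 -> R[i], forall j,
    E ord0 i * x * E j ord0 = f j *: E ord0 ord0.
  by have [f fE] := choice (h i); exists f.
have {h h'} [y yE] := choice h'.
exists (\matrix_(i, j) y i j); rewrite (mu_decomp hE ord0 x).
apply: eq_bigr => i _; apply: eq_bigr => j _.
by rewrite yE mxE -scalerAr -scalerAl !(muM hE, eqxx).
Qed.

End MatrixUnitsNorm.

Section NormUniqueness.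
Variables (R : realType) (X Y : cstarAlgType R) (n : nat).
Variables (E : 'I_n -> 'I_n -> X) (F : 'I_n -> 'I_n -> Y).
Hypotheses (hE : is_mu E) (hF : is_mu F).

Lemma mxev_norm_equiv y : cnorm (mxev E y) <= (n * n)%:R * cnorm (mxev F y).
Proof.
have coef i j : Normc.normc (y i j) <= cnorm (mxev F y).
  have F1 : cnorm (F i i) = 1.
    have := cnorm_sqr (proj2 (mu_proj i hF)); rewrite (proj1 (mu_proj i hF)) expr2.
    have := cnorm_ge0 (F i i); have : cnorm (F i i) != 0.
      by apply: contra_neq (mu_neq0 hF i); apply: cnorm_eq0.
    move=> /eqP F0 _ /eqP; rewrite -{1}[cnorm _]mulr1 => /eqP/mulfI h.
    exact/esym/h/eqP.
  rewrite -[leLHS]mulr1 -F1 -cnormZr -(mxev_coef hF).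
  have := cnormM_le_of
    (cnormM_le_of (mu_norm_le1 i i hF) (lexx (cnorm (mxev F y)))) (mu_norm_le1 j i hF).
  by rewrite mul1r mulr1.
apply: le_trans (cnorm_sum_le _ _ _) _.
rewrite natrM -mulrA mulr_natl -[X in _ *+ X]card_ord -sumr_const.
apply: ler_sum => i _; apply: le_trans (cnorm_sum_le _ _ _) _.
rewrite mulr_natl -[X in _ *+ X]card_ord -sumr_const; apply: ler_sum => j _.
rewrite cnormZr -[leRHS]mulr1.
by rewrite ler_pM ?normc_ge0 ?cnorm_ge0 ?coef // mu_norm_le1.
Qed.

End NormUniqueness.

(** The factor [n * n] of the crude comparison is lost on the powers of the self-adjoint matrix
    [h]. *)
Lemma mxev_norm_le (R : realType) (X Y : cstarAlgType R) n
  (E : 'I_n.+1 -> 'I_n.+1 -> X) (F : 'I_n.+1 -> 'I_n.+1 -> Y) y :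
  is_mu E -> is_mu F -> cnorm (mxev E y) <= cnorm (mxev F y).
Proof.
move=> hE hF; rewrite -(@ler_pXn2r _ 2) ?nnegrE ?cnorm_ge0 // -!cnorm_star.
rewrite -!mxev_star // -!mxevM //; set h := _ *m y.
have sh : star (h : 'M[R[i]]_n.+1) = h by rewrite [LHS]mxstarM /mxstar ctmxK.
have pow (Z : cstarAlgType R) (T : 'I_n.+1 -> 'I_n.+1 -> Z) k : is_mu T ->
    mxev T (h ^+ k) = mxev T h ^+ k.
  move=> hT; elim: k => [|k IH]; first by rewrite !expr0 [LHS]mxev1.
  by rewrite !exprS [LHS]mxevM // IH.
apply: (@le_of_exp2n_le _ _ _ (n.+1 * n.+1)%:R); rewrite ?cnorm_ge0 // => k.
rewrite -!cnorm_exp2n -?mxev_star // -?pow // ?[map_mx _ _]sh //.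
exact: mxev_norm_equiv.
Qed.

Lemma mxev_norm_unique (R : realType) (X Y : cstarAlgType R) n
  (E : 'I_n.+1 -> 'I_n.+1 -> X) (F : 'I_n.+1 -> 'I_n.+1 -> Y) y :
  is_mu E -> is_mu F -> cnorm (mxev E y) = cnorm (mxev F y).
Proof. by move=> hE hF; apply/eqP; rewrite eq_le !mxev_norm_le. Qed.

(** * Perturbation of matrix units *)

Section Perturbation.
Variables (R : realType) (X : cstarAlgType R).

Lemma half_sum_star_close (x a : X) : star x = x ->
  cnorm (2^-1 *: (a + star a) - x) <= cnorm (a - x).
Proof.
move=> sx; rewrite -{1}(half_double x) -scalerDr -scalerBr cnorm_half.
have -> : a + star a - (x + x) = (a - x) + star (a - x) by rewrite starB sx; ncring.
by have := cnormD_le (a - x) (star (a - x)); rewrite cnorm_starE; lra.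
Qed.

(** The self-adjoint part of [a] is within [d] of [q] and has idempotency defect at most [4 * d];
    [near_projection] then costs [40 * d], whence 41. *)
Lemma near_projection_of (S : X -> Prop) (q a : X) (d : R) :
  closed_subalg S -> (forall y, S y -> S (star y)) -> is_proj q -> S a ->
  cnorm (a - q) <= d -> d <= 64^-1 ->
  exists p, [/\ is_proj p, S p & cnorm (p - q) <= 41 * d].
Proof.
move=> hS Sstar hq Sa aq d64; have [qq sq] := hq.
pose x := 2^-1 *: (a + star a).
have sx : star x = x by rewrite star_half starD starK addrC.
have Sx : S x by apply/(csubZ hS)/(csubD hS); last exact: Sstar.
have xq : cnorm (x - q) <= d := le_trans (half_sum_star_close a sq) aq.
have d0 : 0 <= d by apply: le_trans xq; apply: cnorm_ge0.
have q1 := proj_norm_le1 hq.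
have xx : cnorm (x * x - x) <= 4 * d.
  have := cnorm_dist_trans q (x * x) x; rewrite -{1}qq (cnorm_distC q).
  have := cnormM_dist_le x x q q; have := cnorm_le_dist x q.
  have := cnorm_ge0 (x - q); have := cnorm_ge0 q.
  set u := cnorm (x - q) in xq *; set v := cnorm x; set w := cnorm q in q1 *.
  move=> w0 u0 vuw h h'; apply: le_trans h' _.
  have : u * v + w * u <= 3 * d by nra.
  by lra.
have x16 : cnorm (x * x - x) <= 16^-1 by lra.
have [p [hp px pS]] := near_projection sx x16.
exists p; split; [by [] | exact: pS |].
by have := cnorm_dist_trans x p q; lra.
Qed.

(** Approximating one column suffices: it is orthonormalised inside [S] to partial isometries [f i]
    with common source [p], a projection of [S] close to [E k k]. The units [f i * star (f j)] lie
    in [S], and the intertwiner from [E] to them is close to 1. *)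
Theorem mu_perturb (I : finType) (E : I -> I -> X) (k : I) : is_mu E ->
  forall e : R, 0 < e -> exists2 d : R, 0 < d &
  forall S : X -> Prop, closed_subalg S -> (forall y, S y -> S (star y)) ->
    (forall i, exists2 a, S a & cnorm (a - E i k) <= d) ->
  exists w : X, [/\ star w * w = 1, w * star w = 1, cnorm (w - 1) <= e
    & forall i j, S (w * E i j * star w)].
Proof.
move=> hE e e0; pose n : R := #|I|%:R; have n0 : 0 <= n := ler0n _ _.
have E1 i j := mu_norm_le1 i j hE.
have hEk := mu_proj k hE.
pose c := e / (4 * (n + 1)).
have c0 : 0 < c by rewrite divr_gt0 //; lra.
have cE : c * (4 * (n + 1)) = e by rewrite divfK // gt_eqF //; lra.
have [d' d'0 gs] := gram_schmidt_unital X I c0.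
pose t := (1024 * (n + 1))^-1.
have t0 : 0 < t by rewrite invr_gt0; lra.
have tE : t * (1024 * (n + 1)) = 1 by rewrite mulVf // gt_eqF //; lra.
(* The margins cover the errors below: [126 * d + 41 * d] in the Gram matrix, [6 * (41 * d)] for
   [v], [42 * d] for each column entry, and [n * (126 * d)] for the sum of ranges. *)
have [d [d0 dt dd' dc]] : exists d, [/\ 0 < d, d <= t, 200 * d <= d' & 300 * d <= c].
  exists (Num.min t (Num.min (d' / 200) (c / 300))).
  set d := Num.min _ _; have [dt dd' dc] : [/\ d <= t, d <= d' / 200 & d <= c / 300].
    by rewrite !ge_min !lexx !orbT.
  have d'2 : 0 < d' / 200 by lra.
  have c3 : 0 < c / 300 by lra.
  by rewrite lt_min t0 lt_min d'2 c3; split=> //; lra.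
exists d => // S hS Sstar SE.
have [a aP] : exists a : I -> X, forall i, S (a i) /\ cnorm (a i - E i k) <= d.
  have h i : exists x, S x /\ cnorm (x - E i k) <= d.
    by have [x Sx xE] := SE i; exists x.
  by have [a aP] := choice h; exists a.
have tn := mulr_ge0 (ltW t0) n0.
have d1 : d <= 1024^-1 by lra.
have [|p [hp Sp pE]] :=
  near_projection_of hS Sstar hEk (proj1 (aP k)) (proj2 (aP k)); first by lra.
have p1 := proj_norm_le1 hp.
pose x i := a i * p.
have xE i : cnorm (x i - E i k) <= 42 * d.
  have -> : E i k = E i k * E k k by rewrite (muM hE) eqxx.
  apply: le_trans (cnormM_dist_le _ _ _ _) _.
  have := cnormM_le_of (proj2 (aP i)) p1.
  by have := proj2 (aP i); have := cnorm_ge0 (a i - E i k); have := cnorm_ge0 p;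
    have := cnorm_ge0 (p - E k k); have := cnorm_ge0 (E i k); have := E1 i k; nra.
have x2 i : cnorm (x i) <= 2.
  by have := cnorm_le_dist (x i) (E i k); have := xE i; have := E1 i k; lra.
have prod_close (u v u' v' : X) :
    cnorm (u - u') <= 42 * d -> cnorm (v - v') <= 42 * d ->
    cnorm v <= 2 -> cnorm u' <= 1 -> cnorm (u * v - u' * v') <= 126 * d.
  move=> uu vv v2 u1; apply: le_trans (cnormM_dist_le _ _ _ _) _.
  have := ler_pM (cnorm_ge0 _) (cnorm_ge0 _) uu v2.
  by have := ler_pM (cnorm_ge0 _) (cnorm_ge0 _) u1 vv; lra.
have sxE i : cnorm (star (x i) - E k i) <= 42 * d.
  by rewrite -(mu_star hE) -starB cnorm_starE.
have Sx i : S (x i) by apply: (csubM hS) => //; case: (aP i).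
have xp i : x i * p = x i by rewrite /x -mulrA (proj1 hp).
have [i j||f [ff f1 Sf fx]] := gs p S x hp hS Sstar Sp Sx xp.
- have := prod_close (star (x i)) (x j) (E k i) (E j k) (sxE i) (xE j) (x2 j) (E1 k i).
  rewrite (muM hE); have := cnorm_dist_trans (if i == j then E k k else 0)
    (star (x i) * x j) (if i == j then p else 0).
  case: (i == j); last by rewrite subrr cnorm0; lra.
  by rewrite (cnorm_distC (E k k)); lra.
- rewrite -(mu_sum1 hE) -sumrB; apply: le_trans (cnorm_sum_le _ _ _) _.
  apply: (@le_trans _ _ (\sum_(i : I) (126 * d))).
    apply: ler_sum => i _; have := muM hE i k k i; rewrite eqxx => <-.
    by apply: prod_close => //; rewrite cnorm_starE.
  by rewrite sumr_const -mulr_natl -/n; nra.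
have hF := isometries_mu hp ff f1; set F := fun i j => _ in hF.
have [||v [vv vv' vE]] := @close_projections R X (E k k) p (41 * d) hEk hp.
- by rewrite cnorm_distC.
- by lra.
have pv : p * v = v.
  have := isometry_proj hEk vv; rewrite -vv mulrA vv' //.
have ve : v * E k k = v := isometry_proj hEk vv.
have ffp i : f i * p = f i by apply: isometry_proj hp _; rewrite ff eqxx.
have v1 := isometry_norm_le1 hEk vv.
(* [v] ends at [p], which need not be [F k k]; composing with [f k] carries it there. *)
have [|||w1 w2 wE] := @mu_intertwiner _ _ _ E F k (f k * v) hE hF.
- by rewrite starM mulrA -(mulrA (star v)) ff eqxx -mulrA pv.
- by rewrite starM mulrA -(mulrA (f k)) vv' ffp.
- by rewrite -mulrA ve.
set w := \sum_i _ in w1 w2 wE.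
exists w; split=> // [|i j]; last by rewrite wE; apply: (csubM hS) => //; apply: Sstar.
rewrite -(mu_sum1 hE) -sumrB; apply: le_trans (cnorm_sum_le _ _ _) _.
apply: (@le_trans _ _ (\sum_(i : I) (3 * c))); last first.
  by rewrite sumr_const -mulr_natl -/n; nra.
apply: ler_sum => i _.
have -> : F i k * (f k * v) = f i * v by rewrite /F !mulrA -(mulrA (f i)) ff eqxx ffp.
have -> : E i i = E i k * E k k * E k i by rewrite !(muM hE, eqxx).
rewrite -mulrBl.
have f1' : cnorm (f i) <= 1 by apply: isometry_norm_le1 hp _; rewrite ff eqxx.
have h1 : cnorm (f i - E i k) <= c + c / 2.
  by have := cnorm_dist_trans (x i) (f i) (E i k); have := fx i; have := xE i; lra.
have h2 : cnorm (f i * v - E i k * E k k) <= (c + c / 2) * 1 + 1 * c.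
  apply: le_trans (cnormM_dist_le _ _ _ _) _; apply: lerD.
    by rewrite ler_pM ?cnorm_ge0.
  by rewrite ler_pM ?cnorm_ge0 //; lra.
by have := cnormM_le_of h2 (E1 k i); lra.
Qed.

End Perturbation.

(** * Enlarging a given system of matrix units *)

Lemma norm_bound (R : realType) (X : cstarAlgType R) (s : seq X) :
  exists2 M : R, 0 <= M & {in s, forall x, cnorm x <= M}.
Proof.
elim: s => [|x s [M M0 sM]]; first by exists 0.
exists (cnorm x + M); first by rewrite addr_ge0 ?cnorm_ge0.
move=> y; rewrite inE => /orP[/eqP->|/sM yM]; first by rewrite lerDl.
by rewrite (le_trans yM) // lerDr cnorm_ge0.
Qed.

Lemma mxev_conj (K : numClosedFieldType) (X : starAlgType K) n
    (E : 'I_n -> 'I_n -> X) (u v : X) y :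
  mxev (fun i j => u * E i j * v) y = u * mxev E y * v.
Proof.
rewrite /mxev mulr_sumr mulr_suml; apply: eq_bigr => i _.
rewrite mulr_sumr mulr_suml; apply: eq_bigr => j _.
by rewrite -scalerAr -scalerAl.
Qed.

Definition locally_matricial (R : realType) (N : nat) (X : cstarAlgType R) :=
  forall (s : seq X) (e : R), 0 < e ->
  exists m (E : 'I_m.+1 -> 'I_m.+1 -> X), [/\ is_mu E, (N %| m.+1)%N
    & {in s, forall x, exists y, cnorm (x - mxev E y) < e}].

(** Approximate [s] together with a column of [E0] by a system [F]. A unitary [w] near 1 moves [E0]
    into the range of [F]; conjugating [F] back by [star w] makes its range contain [E0] exactly and
    spoils the approximation of [s] only slightly. *)
Theorem locally_matricial_extend (R : realType) (N : nat) (X : cstarAlgType R) :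
  locally_matricial N X -> forall n (E0 : 'I_n.+1 -> 'I_n.+1 -> X), is_mu E0 ->
  forall (s : seq X) (e : R), 0 < e ->
  exists m (E : 'I_m.+1 -> 'I_m.+1 -> X), [/\ is_mu E, (N %| m.+1)%N,
    {in s, forall x, exists y, cnorm (x - mxev E y) < e}
    & forall i j, mx_range E (E0 i j)].
Proof.
move=> locX n E0 hE0 s e e0; have [M M0 sM] := norm_bound s.
pose eta := e / (4 * (M + 1)).
have eta0 : 0 < eta by rewrite divr_gt0 //; lra.
have etaE : eta * (4 * (M + 1)) = e by rewrite divfK // gt_eqF //; lra.
have [d d0 pert] := mu_perturb ord0 hE0 eta0.
have [d' [d'0 d'd d'e]] : exists d', [/\ 0 < d', d' <= d & d' <= e / 4].
  by exists (Num.min d (e / 4)); rewrite lt_min d0 divr_gt0 // !ge_min !lexx orbT.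
have [m [F [hF Nm Fs]]] := locX (s ++ codom (fun i => E0 i ord0)) d' d'0.
have [|i|w [w1 w2 we wS]] := pert (mx_range F) (mx_range_closed_subalg hF).
- by move=> y; apply: mx_range_star.
- have [|y yE] := Fs (E0 i ord0); first by rewrite mem_cat codom_f orbT.
  by exists (mxev F y); [exists y | rewrite cnorm_distC; lra].
exists m, (fun i j => star w * F i j * w); split=> //.
- by have := @mu_conj _ _ _ F (star w); rewrite starK; apply.
- move=> x xs; have [|y xy] := Fs x; first by rewrite mem_cat xs.
  exists y; rewrite mxev_conj.
  have -> : x - star w * mxev F y * w =
    star w * (x - mxev F y) * w + (star w * (w - 1) * x - star w * x * (w - 1)).
    have -> : star w * (w - 1) * x = x - star w * x.
      by rewrite mulrBr w1 mulr1 mulrBl mul1r.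
    by ncring.
  have cw : cnorm w <= 1 by rewrite cnorm_unitary.
  have csw : cnorm (star w) <= 1 by rewrite cnorm_starE.
  apply: le_lt_trans (cnormD_le _ _) _.
  have h1 := cnormM_le_of (cnormM_le_of csw (ltW xy)) cw.
  have h2 := cnormM_le_of (cnormM_le_of csw we) (sM x xs).
  have h3 := cnormM_le_of (cnormM_le_of csw (sM x xs)) we.
  have := cnormB_le (star w * (w - 1) * x) (star w * x * (w - 1)); lra.
move=> i j; have [y yE] := wS i j; exists y; rewrite mxev_conj -yE.
by rewrite !mulrA w1 mul1r -mulrA w1 mulr1.
Qed.

(** * Isometric graphs *)

Lemma inv_nat_small (R : realType) (e : R) : 0 < e ->
  exists N, forall n, (N <= n)%N -> n.+1%:R^-1 < e.
Proof.
move=> e0; exists (Num.bound e^-1) => n Nn.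
rewrite -[e]invrK ltf_pV2 ?posrE ?invr_gt0 //.
apply: lt_le_trans (archi_boundP _) _; first by rewrite invr_ge0 ltW.
by rewrite ler_nat ltnW.
Qed.

Section IsometricGraph.
Variable R : realType.

(** A partial isomorphism kept as a relation, so that increasing unions and the exchange of the two
    sides cost nothing. Linearity and [ig_norm] make it single-valued in both directions. *)
Record isometric_graph (A B : cstarAlgType R) (D : A -> B -> Prop) : Prop :=
  IsometricGraph {
  ig1 : D 1 1;
  igD : forall x y x' y', D x y -> D x' y' -> D (x + x') (y + y');
  igZ : forall (a : R[i]) x y, D x y -> D (a *: x) (a *: y);
  igM : forall x y x' y', D x y -> D x' y' -> D (x * x') (y * y');
  ig_star : forall x y, D x y -> D (star x) (star y);
  ig_norm : forall x y, D x y -> cnorm x = cnorm y }.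

Definition dense_domain (A B : cstarAlgType R) (D : A -> B -> Prop) :=
  forall (a : A) (e : R), 0 < e -> exists x y, D x y /\ cnorm (a - x) < e.

Definition graph_closure (A B : cstarAlgType R) (D : A -> B -> Prop) a b :=
  forall e : R, 0 < e -> exists x y,
    [/\ D x y, cnorm (a - x) < e & cnorm (b - y) < e].

Section Closure.
Variables (A B : cstarAlgType R) (D : A -> B -> Prop).
Hypothesis hD : isometric_graph D.

Lemma mul_close (X : cstarAlgType R) (x x' : X) (e : R) : 0 < e ->
  exists2 d : R, 0 < d & forall y y', cnorm (x - y) < d -> cnorm (x' - y') < d ->
    cnorm (x * x' - y * y') < e.
Proof.
move=> e0; pose c := cnorm x + cnorm x' + 1.
have x0 := cnorm_ge0 x; have x'0 := cnorm_ge0 x'.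
have c1 : 1 <= c by rewrite /c; lra.
have [d [d0 d1 de]] : exists d : R, [/\ 0 < d, d <= 1 & c * d <= e / 2].
  have ec : 0 < e / 2 / c by rewrite !divr_gt0 //; lra.
  exists (Num.min 1 (e / 2 / c)); split; rewrite ?lt_min ?ltr01 ?ge_min ?lexx //.
  rewrite mulrC -ler_pdivlMr; last by lra.
  by rewrite ge_min lexx orbT.
exists d => // y y' xy xy'; apply: le_lt_trans (cnormM_dist_le _ _ _ _) _.
have := cnorm_le_dist y x; rewrite cnorm_distC => yx.
have := cnorm_ge0 (x - y); have := cnorm_ge0 (x' - y'); have := cnorm_ge0 y.
set u := cnorm (x - y) in xy yx *; set v := cnorm (x' - y') in xy' *.
set w := cnorm y in yx * => w0 v0 u0.
have h1 : u * cnorm x' <= d * cnorm x' by rewrite ler_wpM2r // ltW.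
have h2 : w * v <= (d + cnorm x) * d by rewrite ler_pM //; lra.
have h3 : d * d <= d by rewrite -[leRHS]mulr1 ler_wpM2l // ltW.
by rewrite /c in de; lra.
Qed.

Lemma graph_closureM x y x' y' : graph_closure D x y -> graph_closure D x' y' ->
  graph_closure D (x * x') (y * y').
Proof.
move=> xy xy' e e0; have [d d0 hd] := mul_close x x' e0.
have [c c0 hc] := mul_close y y' e0.
have m0 : 0 < Num.min d c by rewrite lt_min d0 c0.
have [a [b [ab xa yb]]] := xy _ m0; have [a' [b' [ab' xa' yb']]] := xy' _ m0.
move: xa yb xa' yb'; rewrite !lt_min.
move=> /andP[xa _] /andP[_ yb] /andP[xa' _] /andP[_ yb'].
by exists (a * a'), (b * b'); split; [apply: igM | apply: hd | apply: hc].
Qed.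

Lemma graph_closureD x y x' y' : graph_closure D x y -> graph_closure D x' y' ->
  graph_closure D (x + x') (y + y').
Proof.
move=> xy xy' e e0; have e2 : 0 < e / 2 by rewrite divr_gt0.
have [a [b [ab xa yb]]] := xy _ e2; have [a' [b' [ab' xa' yb']]] := xy' _ e2.
exists (a + a'), (b + b'); split; first exact: igD.
  by rewrite opprD addrACA; have := cnormD_le (x - a) (x' - a'); lra.
by rewrite opprD addrACA; have := cnormD_le (y - b) (y' - b'); lra.
Qed.

Lemma graph_closureZ (a : R[i]) x y : graph_closure D x y ->
  graph_closure D (a *: x) (a *: y).
Proof.
move=> xy e e0; have a0 := normc_ge0 a; have a1 : 0 < Normc.normc a + 1 by lra.
have d0 : 0 < e / (Normc.normc a + 1) by rewrite divr_gt0.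
have dE : e / (Normc.normc a + 1) * (Normc.normc a + 1) = e by rewrite divfK // gt_eqF.
set d := e / _ in d0 dE.
have h (X : cstarAlgType R) (u v : X) :
    cnorm (u - v) < d -> cnorm (a *: u - a *: v) < e.
  by rewrite -scalerBr cnormZr => uv; have := cnorm_ge0 (u - v); nra.
have [x' [y' [xy' xx' yy']]] := xy _ d0.
by exists (a *: x'), (a *: y'); split; [apply: igZ | apply: h | apply: h].
Qed.

Lemma graph_closure_star x y : graph_closure D x y ->
  graph_closure D (star x) (star y).
Proof.
move=> xy e /xy[x' [y' [xy' xx' yy']]]; exists (star x'), (star y').
by rewrite -!starB !cnorm_starE; split=> //; apply: ig_star.
Qed.

Lemma graph_closure1 : graph_closure D 1 1.
Proof.
by move=> e e0; exists 1, 1; rewrite !subrr !cnorm0; split=> //; apply: ig1.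
Qed.

Lemma graph_closure_norm x y : graph_closure D x y -> cnorm x = cnorm y.
Proof.
move=> xy; apply/eqP; rewrite eq_le; apply/andP; split; apply/ler_addgt0Pr => e e0;
  have [|a [b [ab xa yb]]] := xy (e / 2); rewrite ?divr_gt0 //;
  have := ig_norm hD ab; have := cnorm_le_dist x a; have := cnorm_le_dist b y;
  have := cnorm_le_dist y b; have := cnorm_le_dist a x;
  rewrite (cnorm_distC b) (cnorm_distC a); lra.
Qed.

Lemma graph_closure_unique x y y' : graph_closure D x y ->
  graph_closure D x y' -> y = y'.
Proof.
move=> xy /(graph_closureZ (-1)) /(graph_closureD xy).
rewrite !scaleN1r subrr => /graph_closure_norm/esym; rewrite cnorm0.
by move/cnorm_eq0/eqP; rewrite subr_eq0 => /eqP.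
Qed.

Lemma graph_closure_total : dense_domain D -> forall x, exists y, graph_closure D x y.
Proof.
move=> dD x.
have h n : exists ab : A * B, D ab.1 ab.2 /\ cnorm (x - ab.1) < n.+1%:R^-1.
  have [|a [b [ab xa]]] := dD x n.+1%:R^-1; first by rewrite invr_gt0.
  by exists (a, b).
have {h} [u uP] := choice h.
have small e : 0 < e -> exists N, forall n, (N <= n)%N -> cnorm (x - (u n).1) < e.
  move=> /inv_nat_small[N Nn]; exists N => n /Nn; apply: lt_trans.
  by case: (uP n).
have diff m n : cnorm ((u m).2 - (u n).2) = cnorm ((u m).1 - (u n).1).
  rewrite -!(scaleN1r (_.2)) -!(scaleN1r (_.1)); apply/esym/(ig_norm hD).
  by apply: igD => //; [case: (uP m) | apply: igZ => //; case: (uP n)].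
have [|y uy] := @cnorm_completeN R B (fun n => (u n).2).
  move=> e e0; have [|N xN] := small (e / 2); first by rewrite divr_gt0.
  exists N => m n /xN xm /xN xn; rewrite diff.
  by have := cnorm_dist_trans x (u m).1 (u n).1; rewrite (cnorm_distC _ x); lra.
exists y => e e0; have [N xN] := small e e0; have [M yM] := uy e e0.
exists (u (maxn N M)).1, (u (maxn N M)).2; split; first by case: (uP (maxn N M)).
  exact/xN/leq_maxl.
by rewrite cnorm_distC; apply/yM/leq_maxr.
Qed.

End Closure.

Lemma graph_closure_sym (A B : cstarAlgType R) (D : A -> B -> Prop) x y :
  graph_closure D x y -> graph_closure (fun b a => D a b) y x.
Proof. by move=> xy e /xy[a [b [ab xa yb]]]; exists b, a. Qed.

Theorem isometric_graph_iso (A B : cstarAlgType R) (D : A -> B -> Prop) :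
  isometric_graph D -> dense_domain D -> dense_domain (fun b a => D a b) ->
  cstar_isomorphic A B.
Proof.
move=> hD dD dD'; have hD' : isometric_graph (fun b a => D a b).
  case: hD => D1 DD DZ DM Ds Dn; split=> //.
  - by move=> x y x' y'; apply: DD.
  - by move=> a x y; apply: DZ.
  - by move=> x y x' y'; apply: DM.
  - by move=> x y; apply: Ds.
  by move=> x y /Dn.
have [f fP] := choice (graph_closure_total hD dD).
have [g gP] := choice (graph_closure_total hD' dD').
have fE x y : graph_closure D x y -> f x = y.
  exact: graph_closure_unique (fP x).
have gE x y : graph_closure D x y -> g y = x.
  move=> /graph_closure_sym; exact: graph_closure_unique (gP y).
have flin : linear f.
  by move=> a x y; apply: fE; apply: graph_closureD => //; apply: graph_closureZ.
have fmul : monoid_morphism f.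
  split=> [|x y]; apply: fE; first exact: graph_closure1.
  exact: graph_closureM.
pose F : {lrmorphism A -> B} := HB.pack f
  (GRing.isLinear.Build _ _ _ _ f flin) (GRing.isMonoidMorphism.Build _ _ f fmul).
constructor; exists F.
- by move=> x; apply: fE; apply: graph_closure_star.
- by move=> x; apply/esym; apply: graph_closure_norm (fP x).
by exists g => x; [apply/gE | apply/fE/(@graph_closure_sym _ _ (fun b a => D a b))].
Qed.

End IsometricGraph.

(** * Elliott's intertwining *)

Section Intertwining.
Variable R : realType.

(** The lists together span a dense subspace, stated as an induction principle. This is the form in
    which separability enters. *)
Definition generating (X : cstarAlgType R) (F : nat -> seq X) :=
  forall S : X -> Prop, closed_set S ->
    (forall x y, S x -> S y -> S (x + y)) -> (forall (a : R[i]) x, S x -> S (a *: x)) ->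
    (forall k x, x \in F k -> S x) -> forall x, S x.

Definition mu_graph (X Y : cstarAlgType R) n (E : 'I_n -> 'I_n -> X)
  (F : 'I_n -> 'I_n -> Y) x y := exists z, x = mxev E z /\ y = mxev F z.

(** Only the [X] side gains accuracy here; exchanging [X] and [Y] gives the other half of the
    back-and-forth. *)
Lemma intertwining_step (X Y : cstarAlgType R) :
  (forall N, locally_matricial N.+1 X) -> (forall N, locally_matricial N.+1 Y) ->
  forall n (E : 'I_n.+1 -> 'I_n.+1 -> X) (E' : 'I_n.+1 -> 'I_n.+1 -> Y),
  is_mu E -> is_mu E' -> forall (s : seq X) (e : R), 0 < e ->
  exists m (F : 'I_m.+1 -> 'I_m.+1 -> X) (F' : 'I_m.+1 -> 'I_m.+1 -> Y),
  [/\ is_mu F, is_mu F',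
      forall x y, mu_graph E E' x y -> mu_graph F F' x y
    & {in s, forall x, exists x' y', mu_graph F F' x' y' /\ cnorm (x - x') < e}].
Proof.
move=> locX locY n E E' hE hE' s e e0.
have [m [F [hF _ sF /= EF]]] := locally_matricial_extend (locX 0%N) hE s e0.
(* Taking [locY m] makes [l.+1] a multiple of [m.+1], so that the larger matrices contain the
   smaller ones unitally. *)
have [l [F'' [hF'' ml _ E'F]]] :=
  locally_matricial_extend (locY m) hE' [::] e0.
have hT i : exists f : 'I_n.+1 -> 'M[R[i]]_m.+1, forall j, E i j = mxev F (f j).
  by have [f] := choice (EF i); exists f.
have {hT} [T ET] := choice hT.
have hT i : exists f : 'I_n.+1 -> 'M[R[i]]_l.+1, forall j, E' i j = mxev F'' (f j).
  by have [f] := choice (E'F i); exists f.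
have {hT} [T' ET'] := choice hT.
have muT : is_mu T.
  apply/(mu_mxev _ hF); case: hE => M1 S1 U1; split=> [i j k r|i j|].
  - by rewrite -!ET.
  - by rewrite -!ET.
  by rewrite -U1; apply: eq_bigr => i _; rewrite ET.
have muT' : is_mu T'.
  apply/(mu_mxev _ hF''); case: hE' => M1 S1 U1; split=> [i j k r|i j|].
  - by rewrite -!ET'.
  - by rewrite -!ET'.
  by rewrite -U1; apply: eq_bigr => i _; rewrite ET'.
(* The image of [T] under [Q] and the system [T'] are two copies of the same units in the matrices
   of size [l.+1]. Conjugating [Q] by [w] makes them equal, and so the new pair extends the old
   one. *)
have [Q hQ] := @mu_mx_exists R[i] l m ml.
have hQT : is_mu (fun i j => mxev Q (T i j)) by apply/(mu_mxev _ hQ).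
have [w [w1 w2 wT]] := mu_mx_conj hQT muT'.
have hwQ := mu_conj w1 w2 hQ.
exists m, F, (fun i j => mxev F'' (w * Q i j * star w)); split=> //.
- exact/(mu_mxev _ hF'').
- move=> _ _ [z [-> ->]]; exists (mxev T z).
  split; first by rewrite -mxev_mxev; apply: eq_mxev.
  rewrite [RHS]mxev_mxev mxev_conj -mxev_mxev -mxev_conj -mxev_mxev.
  by apply: eq_mxev => i j; rewrite wT.
move=> x /sF[y xy]; exists (mxev F y).
exists (mxev (fun i j => mxev F'' (w * Q i j * star w)) y).
by split=> //; exists y.
Qed.

Lemma mu_graph_isometric (X Y : cstarAlgType R) n (E : 'I_n.+1 -> 'I_n.+1 -> X)
    (F : 'I_n.+1 -> 'I_n.+1 -> Y) : is_mu E -> is_mu F ->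
  isometric_graph (mu_graph E F).
Proof.
move=> hE hF; split.
- by exists 1%:M; rewrite !mxev1.
- by move=> _ _ _ _ [y [-> ->]] [z [-> ->]]; exists (y + z); rewrite !mxevD.
- by move=> a _ _ [y [-> ->]]; exists (a *: y); rewrite !mxevZ.
- by move=> _ _ _ _ [y [-> ->]] [z [-> ->]]; exists (y *m z); rewrite !mxevM.
- by move=> _ _ [y [-> ->]]; exists (map_mx Num.conj y^T); rewrite !mxev_star.
by move=> _ _ [y [-> ->]]; apply: mxev_norm_unique.
Qed.

Lemma mu_graphC (X Y : cstarAlgType R) n (E : 'I_n -> 'I_n -> X)
  (F : 'I_n -> 'I_n -> Y) x y : mu_graph E F x y -> mu_graph F E y x.
Proof. by case=> z [-> ->]; exists z. Qed.

Record mu_pair (X Y : cstarAlgType R) := MuPair {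
  mp_size : nat;
  mp_fst : 'I_mp_size.+1 -> 'I_mp_size.+1 -> X;
  mp_snd : 'I_mp_size.+1 -> 'I_mp_size.+1 -> Y;
  mp_mu1 : is_mu mp_fst;
  mp_mu2 : is_mu mp_snd }.

Definition mp_graph (X Y : cstarAlgType R) (P : mu_pair X Y) :=
  mu_graph (@mp_fst _ _ P) (@mp_snd _ _ P).

Lemma intertwining_two_steps (X Y : cstarAlgType R) :
  (forall N, locally_matricial N.+1 X) -> (forall N, locally_matricial N.+1 Y) ->
  forall (P : mu_pair X Y) (s : seq X) (t : seq Y) (e : R), 0 < e ->
  exists Q : mu_pair X Y,
    [/\ forall x y, mp_graph P x y -> mp_graph Q x y,
        {in s, forall x, exists x' y', mp_graph Q x' y' /\ cnorm (x - x') < e}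
      & {in t, forall y, exists x' y', mp_graph Q x' y' /\ cnorm (y - y') < e}].
Proof.
move=> locX locY [n E E' hE hE'] s t e e0.
have [m [F [F' [hF hF' EF sF]]]] := intertwining_step locX locY hE hE' s e0.
have [l [G' [G [hG' hG FG tG]]]] := intertwining_step locY locX hF' hF t e0.
have FG' x y : mu_graph F F' x y -> mu_graph G G' x y.
  by move=> /mu_graphC/FG/mu_graphC.
exists (MuPair hG hG'); split.
- by move=> x y /EF/FG'.
- by move=> x /sF[x' [y' [/FG' xy' xx']]]; exists x', y'.
by move=> y /tG[y' [x' [/mu_graphC xy' yy']]]; exists x', y'.
Qed.

Theorem locally_matricial_isomorphic (X Y : cstarAlgType R)
    (FX : nat -> seq X) (FY : nat -> seq Y) :
  (forall N, locally_matricial N.+1 X) -> (forall N, locally_matricial N.+1 Y) ->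
  generating FX -> generating FY -> cstar_isomorphic X Y.
Proof.
move=> locX locY genX genY.
(* Stage [k] treats all lists up to index [k] within [1 / (k + 1)], so every list recurs with
   precision tending to 0. *)
pose sX k := flatten [seq FX i | i <- iota 0 k.+1].
pose sY k := flatten [seq FY i | i <- iota 0 k.+1].
have mu_one (Z : cstarAlgType R) : is_mu (fun i j : 'I_1 => 1 : Z).
  split=> [i j k l|i j|]; last by rewrite big_ord1.
    by rewrite !ord1 eqxx mulr1.
  exact: star1.
have h (kP : nat * mu_pair X Y) : exists Q : mu_pair X Y,
    [/\ forall x y, mp_graph kP.2 x y -> mp_graph Q x y,
        {in sX kP.1, forall x, exists x' y',
          mp_graph Q x' y' /\ cnorm (x - x') < kP.1.+1%:R^-1}
      & {in sY kP.1, forall y, exists x' y',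
          mp_graph Q x' y' /\ cnorm (y - y') < kP.1.+1%:R^-1}].
  by apply: intertwining_two_steps; rewrite // invr_gt0.
have {h} [next nextP] := choice h.
pose P := fix P k :=
  if k is k'.+1 then next (k', P k') else MuPair (mu_one X) (mu_one Y).
have Pstep k x y : mp_graph (P k) x y -> mp_graph (P k.+1) x y.
  by have [h _ _] := nextP (k, P k); apply: h.
have Pmono k l x y : (k <= l)%N -> mp_graph (P k) x y -> mp_graph (P l) x y.
  move=> kl Pk; rewrite -(subnKC kl); elim: (l - k)%N => [|d IH].
    by rewrite addn0.
  by rewrite addnS; apply: Pstep.
have isoP k : isometric_graph (mp_graph (P k)).
  by apply: mu_graph_isometric; [apply: mp_mu1 | apply: mp_mu2].
pose D x y := exists k, mp_graph (P k) x y.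
have join x y x' y' : D x y -> D x' y' ->
    exists k, mp_graph (P k) x y /\ mp_graph (P k) x' y'.
  move=> [k xy] [l xy']; exists (maxn k l); split.
    exact: Pmono (leq_maxl _ _) xy.
  exact: Pmono (leq_maxr _ _) xy'.
have hD : isometric_graph D.
  split.
  - by exists 0%N; apply: (ig1 (isoP 0%N)).
  - by move=> x y x' y' xy /(join _ _ _ _ xy)[k [? ?]]; exists k; apply: (igD (isoP k)).
  - by move=> a x y [k xy]; exists k; apply: (igZ (isoP k)).
  - by move=> x y x' y' xy /(join _ _ _ _ xy)[k [? ?]]; exists k; apply: (igM (isoP k)).
  - by move=> x y [k xy]; exists k; apply: (ig_star (isoP k)).
  by move=> x y [k xy]; apply: (ig_norm (isoP k)).
have mem_s (Z : eqType) (F : nat -> seq Z) k l z : (k <= l)%N -> z \in F k ->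
    z \in flatten [seq F i | i <- iota 0 l.+1].
  by move=> kl zk; apply/flatten_mapP; exists k => //; rewrite mem_iota ltnS.
suff dense (V W : cstarAlgType R) (F : nat -> seq V) (D' : V -> W -> Prop) :
    isometric_graph D' -> generating F ->
    (forall k x e, x \in F k -> 0 < e ->
      exists x' y', D' x' y' /\ cnorm (x - x') < e) ->
    dense_domain D'.
  apply: (isometric_graph_iso hD); apply: dense.
  - exact: hD.
  - exact: genX.
  - move=> k x e xk /inv_nat_small[N Ne]; set l := maxn k N.
    have [_ sP _] := nextP (l, P l).
    have [|x' [y' [xy' xx']]] := sP x; first exact: mem_s (leq_maxl k N) xk.
    exists x', y'; split; first by exists l.+1.
    by apply: lt_trans xx' _; apply/Ne/leq_maxr.
  - split.
    + by exists 0%N; apply: (ig1 (isoP 0%N)).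
    + by move=> x y x' y'; apply: igD.
    + by move=> a x y; apply: igZ.
    + by move=> x y x' y'; apply: igM.
    + by move=> x y; apply: ig_star.
    by move=> x y /(ig_norm hD).
  - exact: genY.
  move=> k y e yk /inv_nat_small[N Ne]; set l := maxn k N.
  have [_ _ tP] := nextP (l, P l).
  have [|x' [y' [xy' yy']]] := tP y; first exact: mem_s (leq_maxl k N) yk.
  exists y', x'; split; first by exists l.+1.
  by apply: lt_trans yy' _; apply/Ne/leq_maxr.
move=> hD' genV FD a.
(* The approximable elements form a closed linear subspace, so the generating lists suffice. *)
pose S x := forall e : R, 0 < e -> exists x' y', D' x' y' /\ cnorm (x - x') < e.
apply: (genV S) => [x xS e e0|x y Sx Sy e e0|c x Sx e e0|k x xk e]; last exact: FD xk.
- have e2 : 0 < e / 2 by rewrite divr_gt0.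
  have [y Sy xy] := xS _ e2; have [x' [y' [xy' yx']]] := Sy _ e2.
  by exists x', y'; split=> //; have := cnorm_dist_trans y x x'; lra.
- have e2 : 0 < e / 2 by rewrite divr_gt0.
  have [x1 [y1 [d1 xx]]] := Sx _ e2; have [x2 [y2 [d2 yy]]] := Sy _ e2.
  exists (x1 + x2), (y1 + y2); split; first exact: (igD hD').
  by rewrite opprD addrACA; have := cnormD_le (x - x1) (y - x2); lra.
have c0 := normc_ge0 c; have c1 : 0 < Normc.normc c + 1 by lra.
have [|x1 [y1 [d1 xx]]] := Sx (e / (Normc.normc c + 1)); first by rewrite divr_gt0.
exists (c *: x1), (c *: y1); split; first exact: (igZ hD').
rewrite -scalerBr cnormZr; move: xx; rewrite ltr_pdivlMr //.
by have := cnorm_ge0 (x - x1); nra.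
Qed.

End Intertwining.

(** * UHF towers *)

Section Tower.
Variables (R : realType) (U : cstarAlgType R) (T : uhf_tower U).

Definition tower_mu k (i j : 'I_(tower_dim T k).+1) : U :=
  tower_emb T k (delta_mx i j).

Lemma tower_mu_is_mu k : is_mu (@tower_mu k).
Proof.
exact: (mu_morph (@tower_star _ _ T k) (mu_delta _ _)).
Qed.

Lemma tower_ev k y : mxev (@tower_mu k) y = tower_emb T k y.
Proof.
rewrite -(mxev_morph (tower_emb T k)); congr (tower_emb T k _).
by rewrite [RHS]matrix_sum_delta.
Qed.

Lemma tower_mono k l x : (k <= l)%N -> exists y, tower_emb T l y = tower_emb T k x.
Proof.
move=> kl; rewrite -(subnKC kl); elim: (l - k)%N => [|d [y yx]].
  by rewrite addn0; exists x.
by rewrite addnS; have [z zy] := tower_incr y; exists z; rewrite zy.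
Qed.

Lemma tower_dvdn k l : (k <= l)%N -> ((tower_dim T k).+1 %| (tower_dim T l).+1)%N.
Proof.
move=> kl; have h i : exists f : 'I__ -> 'M[R[i]]_((tower_dim T l).+1),
    forall j, tower_emb T l (f j) = tower_emb T k (delta_mx i j).
  by have [f] := choice (fun j => tower_mono (delta_mx i j) kl); exists f.
have [F FE] := choice h; apply: (@mu_mx_dvdn _ _ _ F).
apply/(mu_mxev _ (tower_mu_is_mu l)); have [M1 S1 U1] := tower_mu_is_mu k.
split=> [i j a b|i j|].
- by rewrite !tower_ev !FE; apply: M1.
- by rewrite !tower_ev !FE; apply: S1.
by rewrite -U1; apply: eq_bigr => i _; rewrite tower_ev FE.
Qed.

Lemma tower_approx (s : seq U) (e : R) : 0 < e ->
  exists k, forall l, (k <= l)%N ->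
    {in s, forall x, exists y, cnorm (x - mxev (@tower_mu l) y) < e}.
Proof.
move=> e0; elim: s => [|x s [k kP]]; first by exists 0%N.
have [k' [y xy]] := tower_dense T x e0.
exists (maxn k k') => l; rewrite geq_max => /andP[kl kl'] z.
rewrite inE => /orP[/eqP->|zs]; last exact: kP.
by have [w wy] := tower_mono y kl'; exists w; rewrite tower_ev wy.
Qed.

Definition tower_units k :=
  [seq tower_mu ij.1 ij.2 | ij : 'I_(tower_dim T k).+1 * 'I_(tower_dim T k).+1].

Lemma tower_generating : generating tower_units.
Proof.
move=> S Sc SD SZ Su x.
have SE k i j : S (@tower_mu k i j).
  by apply: (Su k); apply/mapP; exists (i, j); rewrite ?mem_enum.
have S0 : S 0 by rewrite -(scale0r (@tower_mu 0%N ord0 ord0)); apply: SZ.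
apply: Sc => e /(tower_dense T x)[k [y xy]]; exists (tower_emb T k y) => //.
rewrite -tower_ev; apply: big_ind => // i _; apply: big_ind => // j _.
exact: SZ.
Qed.

Lemma supernatural_dvdn : (forall p m : nat, prime p ->
    (m%:R%:E <= supernatural T p)%E) ->
  forall N, exists k, (N.+1 %| (tower_dim T k).+1)%N.
Proof.
move=> supT N.
have h p : exists k, prime p -> (logn p N.+1 <= logn p (tower_dim T k).+1)%N.
  have [pp|_] := boolP (prime p); last by exists 0%N.
  (* Asking for one more than [logn p N.+1] makes the inequality strict, so that some stage exceeds
     the exponent. *)
  have /ereal.ereal_sup_gt[_ [k _ <-]] : ((logn p N.+1)%:R%:E < supernatural T p)%E.
    by apply: lt_le_trans (supT p (logn p N.+1).+1 pp); rewrite lte_fin ltr_nat.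
  by rewrite lte_fin ltr_nat => /ltnW ?; exists k.
(* The primes dividing [N.+1] are below [N.+2], and sizes divide one another along the tower, so the
   largest of finitely many stages serves all of them. *)
have [K KP] := choice h; pose k := \max_(p < N.+2) K p; exists k.
apply/dvdn_partP => // p; rewrite mem_primes => /and3P[pp _ pN].
have pk : (K p <= k)%N.
  have pN2 : (p < N.+2)%N by rewrite ltnS; apply: dvdn_leq.
  exact: (@leq_bigmax _ (fun q : 'I_N.+2 => K q) (Ordinal pN2)).
rewrite p_part pfactor_dvdn //; apply: leq_trans (KP p pp) _.
by apply: dvdn_leq_log => //; apply: tower_dvdn.
Qed.

Lemma tower_locally_matricial : (forall p m : nat, prime p ->
    (m%:R%:E <= supernatural T p)%E) ->
  forall N, locally_matricial N.+1 U.
Proof.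
move=> supT N s e e0; have [k kP] := tower_approx s e0.
have [l lN] := supernatural_dvdn supT N.
exists (tower_dim T (maxn k l)), (@tower_mu (maxn k l)); split.
- exact: tower_mu_is_mu.
- exact: dvdn_trans lN (tower_dvdn (leq_maxr _ _)).
exact/kP/leq_maxl.
Qed.

End Tower.

(** * The Rokhlin property *)

Section RokhlinApproximation.
Variables (R : realType) (G : finGroupType) (U : cstarAlgType R).
Variable alpha : cstar_action G U.

Lemma c0_eventually (s : seq (linf U)) (e : R) : 0 < e ->
  {in s, forall z, z \in @c0 R U} ->
  exists N, forall n, (N <= n)%N -> {in s, forall z : linf U, cnorm (z n) < e}.
Proof.
move=> e0; elim: s => [|z s IH] zs; first by exists 0%N.
have [N NP] := IH (fun y ys => zs y (mem_behead (ys : y \in behead (z :: s)))).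
have /asboolP/cvgrPdist_lt/(_ e e0)[M _ MP] := zs z (mem_head _ _).
exists (maxn N M) => n; rewrite geq_max => /andP[Nn Mn] y.
rewrite inE => /orP[/eqP->|]; last exact: NP.
by have := MP n Mn; rewrite /= sub0r normrN ger0_norm ?cnorm_ge0.
Qed.

Lemma pi_seq_eq0 (x : linf U) : \pi_(seq_alg U)%qT x = 0 -> x \in @c0 R U.
Proof.
move=> x0; rewrite -[x]subr0; apply/seq_alg_eqP; rewrite x0.
by apply/esym; apply: lock.
Qed.

Lemma pi_seq_eq (x y : linf U) :
  \pi_(seq_alg U)%qT x = \pi_(seq_alg U)%qT y -> x - y \in @c0 R U.
Proof. by move/seq_alg_eqP. Qed.

(** Only [E 1%g] is lifted; the translates of the lift represent the other projections. The finitely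
    many relations become sequences in [c0], and [a] is a term of the lift at an index where all of
    them are small. *)
Theorem rokhlin_almost_projection : Rokhlin alpha ->
  forall (s : seq U) (e : R), 0 < e -> exists a : U,
  [/\ cnorm (a * a - a) < e /\ cnorm (star a - a) < e,
      {in s, forall b, cnorm (a * b - b * a) < e},
      forall g, g != 1%g -> cnorm (alpha g a * a) < e
    & cnorm (\sum_g alpha g a - 1) < e].
Proof.
case=> E [Ecentral Eproj Eorth E1 Eact] s e e0.
pose x : linf U := repr (E 1%g).
have xE : \pi_(seq_alg U)%qT x = E 1%g by apply: reprK.
pose y g := linf_entrywise (cstar_iso_norm (alpha g)) x.
have yE g : \pi_(seq_alg U)%qT (y g) = E g.
  have := Eact g 1%g; rewrite mulg1 -xE => <-; rewrite -pi_entrywise //.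
  by move=> u v; rewrite raddfB.
pose c (b : U) : linf U := Linf (const_seq_subproof b).
pose xs : linf U := linf_entrywise (@cnorm_starE R U) x.
have hM (u v : linf U) :
    \pi_(seq_alg U)%qT u * \pi_(seq_alg U)%qT v = \pi_(seq_alg U)%qT (u * v).
  by rewrite pi_seq_mul.
pose L := [:: x * x - x; xs - x; \sum_g y g - 1] ++ [seq x * c b - c b * x | b <- s] ++
  [seq y g * x | g <- enum G & g != 1%g].
have [|N NP] := @c0_eventually L e e0.
  move=> z; rewrite mem_cat => /orP[|]; last first.
    rewrite mem_cat => /orP[/mapP[b bs ->]|/mapP[g]].
      by apply: pi_seq_eq; rewrite -!hM xE; apply: Ecentral.
    rewrite mem_filter => /andP[g1 _] ->; apply: pi_seq_eq0.
    by rewrite -hM yE xE; apply: Eorth.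
  rewrite !in_cons in_nil orbF => /or3P[] /eqP->; apply: pi_seq_eq.
  - by rewrite -hM xE; case: (Eproj 1%g).
  - rewrite -pi_entrywise; first by rewrite xE; case: (Eproj 1%g).
    exact: starB.
  rewrite -[RHS]/(1 : seq_alg U) -E1.
  have pi0 : \pi_(seq_alg U)%qT (0 : linf U) = 0 by apply: lock.
  rewrite (big_morph _ (@pi_seq_add R U) pi0).
  by apply: eq_bigr => g _; rewrite yE.
exists (x N); have {}NP := NP N (leqnn N).
split.
- split; first by apply: (NP (x * x - x)); rewrite !inE eqxx.
  by apply: (NP (xs - x)); rewrite !inE eqxx orbT.
- move=> b bs; apply: (NP (x * c b - c b * x)).
  rewrite mem_cat; apply/orP; right; rewrite mem_cat; apply/orP; left.
  by apply/mapP; exists b.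
- move=> g g1; apply: (NP (y g * x)).
  rewrite mem_cat; apply/orP; right; rewrite mem_cat; apply/orP; right.
  by apply/mapP; exists g => //; rewrite mem_filter g1 mem_enum.
have -> : \sum_g alpha g (x N) - 1 = (\sum_g y g - 1 : linf U) N.
  rewrite -[RHS]/((\sum_g y g : linf U) N - 1); congr (_ - _).
  by rewrite (big_morph (fun z : linf U => z N) (id1 := 0) (op1 := +%R)).
by apply: (NP (\sum_g y g - 1)); rewrite !inE eqxx !orbT.
Qed.

End RokhlinApproximation.

Section RokhlinProjection.
Variables (R : realType) (G : finGroupType) (U : cstarAlgType R).
Variable alpha : cstar_action G U.

(** The self-adjoint part [y] is within [d] of [a] and has defect at most [7 * d], below 16^-1 by
    the bound on [d]; 71 is 10 times 7 plus 1. *)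
Lemma near_projection_of_almost (a : U) (d : R) : 0 < d -> d <= 128^-1 ->
  cnorm (a * a - a) < d -> cnorm (star a - a) < d ->
  exists2 p, is_proj p & cnorm (p - a) <= 71 * d.
Proof.
move=> d0 d128 aa sa; pose y := 2^-1 *: (a + star a).
have sy : star y = y by rewrite star_half starD starK addrC.
have ya : cnorm (y - a) <= d.
  rewrite -{1}(half_double a) -scalerDr -scalerBr cnorm_half.
  by rewrite opprD addrACA subrr add0r; lra.
have a2 : cnorm a <= 2.
  have := cnorm_star a; rewrite expr2.
  have -> : star a * a = (star a - a) * a + (a * a - a) + a by ncring.
  have := cnormD_le ((star a - a) * a + (a * a - a)) a.
  have := cnormD_le ((star a - a) * a) (a * a - a).
  have := cnormM_le (star a - a) a; have := cnorm_ge0 a.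
  set t := cnorm a; set u := cnorm (star a - a) in sa * => t0 h1 h2 h3 h4.
  have : t * t <= d * t + d + t by have := ler_wpM2r t0 (ltW sa); lra.
  by nra.
have y2 : cnorm y <= 2 + d by have := cnorm_le_dist y a; lra.
have yy : cnorm (y * y - y) <= 7 * d.
  have -> : y * y - y = (y * y - a * a) + (a * a - a) + (a - y) by ncring.
  have := cnormD_le ((y * y - a * a) + (a * a - a)) (a - y).
  have := cnormD_le (y * y - a * a) (a * a - a).
  have := cnormM_dist_le y y a a; rewrite (cnorm_distC a y).
  have := cnormM_le_of ya y2; have := cnorm_ge0 (y - a); have := cnorm_ge0 a.
  have := cnorm_ge0 y; set u := cnorm (y - a) in ya *; set v := cnorm y in y2 *.
  set w := cnorm a in a2 * => v0 w0 u0 _ h1 h2 h3.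
  have h4 : u * v <= d * (2 + d) by rewrite ler_pM.
  have h5 : w * u <= 2 * d by rewrite ler_pM.
  have h6 : d * d <= d by rewrite -[leRHS]mulr1 ler_wpM2l //; lra.
  by lra.
have y16 : cnorm (y * y - y) <= 16^-1 by lra.
have [p [hp py _]] := near_projection sy y16; exists p => //.
by have := cnorm_dist_trans y p a; lra.
Qed.

Theorem rokhlin_projection : Rokhlin alpha ->
  forall (s : seq U) (e : R), 0 < e -> exists p : U,
  [/\ is_proj p, {in s, forall b, cnorm (b * p - p * b) <= e},
      forall g, g != 1%g -> cnorm (alpha g p * p) <= e
    & cnorm (\sum_g alpha g p - 1) <= e].
Proof.
move=> hR s e e0; have [M M0 sM] := norm_bound s.
pose n : R := #|G|%:R; have n0 : 0 <= n := ler0n _ _.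
(* Replacing [a] by [p] costs [71 * d] each time: the commutators are at most [142 * d * M + d], the
   products [214 * d], and the sum [n * (71 * d) + d]. *)
pose c := e / (142 * (M + n + 4)).
have c0 : 0 < c by rewrite divr_gt0 //; lra.
have cE : c * (142 * (M + n + 4)) = e by rewrite divfK // gt_eqF //; lra.
have [d [d0 d1 dc]] : exists d : R, [/\ 0 < d, d <= 128^-1 & d <= c].
  exists (Num.min 128^-1 c); rewrite lt_min c0 !ge_min !lexx orbT.
  by rewrite invr_gt0 ltr0n.
have [a [[aa sa] ab aorth a1]] := rokhlin_almost_projection hR s d0.
have [p hp pa] := near_projection_of_almost d0 d1 aa sa.
have p1 := proj_norm_le1 hp.
have cM := mulr_ge0 (ltW c0) M0; have cn := mulr_ge0 (ltW c0) n0.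
exists p; split=> // [b bs|g g1|].
- have -> : b * p - p * b = b * (p - a) - (p - a) * b - (a * b - b * a) by ncring.
  have := cnormB_le (b * (p - a) - (p - a) * b) (a * b - b * a).
  have := cnormB_le (b * (p - a)) ((p - a) * b).
  have := cnormM_le_of (sM b bs) pa; have := cnormM_le_of pa (sM b bs).
  have := ab b bs; have := ler_wpM2l M0 dc; lra.
- have -> : alpha g p * p = alpha g (p - a) * p + alpha g a * (p - a) + alpha g a * a.
    by rewrite raddfB; ncring.
  have aga : cnorm (alpha g a) <= 2.
    by rewrite cstar_iso_norm; have := cnorm_le_dist a p; rewrite cnorm_distC; lra.
  have agp : cnorm (alpha g (p - a)) <= 71 * d by rewrite cstar_iso_norm.
  have := cnormD_le (alpha g (p - a) * p + alpha g a * (p - a)) (alpha g a * a).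
  have := cnormD_le (alpha g (p - a) * p) (alpha g a * (p - a)).
  have := cnormM_le_of agp p1; have := cnormM_le_of aga pa.
  have := aorth g g1; lra.
have -> : \sum_g alpha g p - 1 = \sum_g alpha g (p - a) + (\sum_g alpha g a - 1).
  rewrite addrA -big_split; congr (_ - _); apply: eq_bigr => g _.
  by rewrite raddfB /= subrK.
apply: le_trans (cnormD_le _ _) _.
have : cnorm (\sum_g alpha g (p - a)) <= n * (71 * d).
  apply: le_trans (cnorm_sum_le _ _ _) _; rewrite /n mulr_natl -sumr_const.
  by apply: ler_sum => g _; rewrite cstar_iso_norm.
by have := ler_wpM2l n0 dc; lra.
Qed.

End RokhlinProjection.

(** Matrix units [w] of the corner of [q] are spread over the whole algebra by partial isometries
    [t i] with source [q]: the tensor product of the units indexed by [I] and by [J]. *)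
Lemma mu_amplify (K : numClosedFieldType) (X : starAlgType K) (I J : finType)
    (t : I -> X) (w : J -> J -> X) (q : X) :
  (forall i k, star (t i) * t k = if i == k then q else 0) ->
  (forall i, t i * q = t i) -> \sum_i t i * star (t i) = 1 ->
  (forall a b c d, w a b * w c d = if b == c then w a d else 0) ->
  (forall a b, star (w a b) = w b a) -> \sum_a w a a = q ->
  is_mu (fun x y : I * J => t x.1 * w x.2 y.2 * star (t y.1)).
Proof.
move=> tt tq t1 ww sw w1; have wq a b : w a b * q = w a b.
  rewrite -w1 mulr_sumr (bigD1 b) //= ww eqxx big1 ?addr0 // => c cb.
  by rewrite ww eq_sym (negPf cb).
split=> [[i a] [k b] [l c] [m d]|[i a] [k b]|] /=.
- have -> : t i * w a b * star (t k) * (t l * w c d * star (t m)) =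
    t i * (w a b * (star (t k) * t l) * w c d) * star (t m) by rewrite !mulrA.
  rewrite tt xpair_eqE; case: (k == l) => /=; last by rewrite mulr0 mul0r mulr0 mul0r.
  by rewrite wq ww; case: (b == c); rewrite // mulr0 mul0r.
- by rewrite !starM starK sw mulrA.
rewrite -(pair_bigA _ (fun i a => t i * w a a * star (t i))) /= -t1.
apply: eq_bigr => i _; rewrite -mulr_suml -mulr_sumr w1 tq //.
Qed.

(** * The crossed product *)

Section CovariantRepresentation.
Variables (R : realType) (G : finGroupType) (U : cstarAlgType R).
Variable alpha : cstar_action G U.

(** The monomial usually written [a u_g]. *)
Definition conv_single (g : G) (a : U) : conv_alg alpha :=
  [ffun s => if s == g then a else 0].

Lemma conv_singleM g h a b :
  conv_single g a * conv_single h b = conv_single (g * h)%g (a * alpha g b).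
Proof.
apply/ffunP => s; rewrite !ffunE (bigD1 g) //= big1 ?addr0 => [|t /negPf tg].
  rewrite !ffunE eqxx; have -> : (g^-1 * s == h)%g = (s == g * h)%g.
    by apply/eqP/eqP => [<-|->]; rewrite ?mulKVg ?mulKg.
  by case: eqP => // _; rewrite raddf0 mulr0.
by rewrite !ffunE tg mul0r.
Qed.

Lemma conv_single_linear g : linear (conv_single g).
Proof.
move=> c a b; apply/ffunP => s; rewrite !ffunE.
by case: eqP => // _; rewrite scaler0 addr0.
Qed.

Lemma conv_single_star g a :
  star (conv_single g a) = conv_single g^-1%g (alpha g^-1%g (star a)).
Proof.
apply/ffunP => s; rewrite !ffunE -eq_invg_sym; case: eqP => [<-|_].
  by rewrite invgK.
by rewrite star0 raddf0.
Qed.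

Lemma conv_single1 : conv_single 1%g 1 = 1.
Proof. by []. Qed.

Lemma conv_sum_single (f : conv_alg alpha) : f = \sum_g conv_single g (f g).
Proof.
apply/ffunP => s; rewrite sum_ffunE (bigD1 s) //= ffunE eqxx.
by rewrite big1 ?addr0 // => g /negPf gs; rewrite ffunE eq_sym gs.
Qed.

(** Lets the remaining argument speak only of a covariant representation whose integrated forms are
    dense in [B]. *)
Lemma covariant_rep_of_morph (B : cstarAlgType R)
    (j : {lrmorphism conv_alg alpha -> B}) : star_preserving j ->
  exists r : covariant_rep alpha B, forall f, integrated_form r f = j f.
Proof.
move=> jstar.
pose f a := j (conv_single 1%g a); pose u g := j (conv_single g 1).
have flin : linear f by move=> c a b; rewrite /f conv_single_linear linearP.
have fmul : monoid_morphism f.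
  split=> [|a b]; rewrite /f; first by rewrite conv_single1 rmorph1.
  by rewrite -rmorphM conv_singleM mulg1 act_1.
pose F : {lrmorphism U -> B} := HB.pack f
  (GRing.isLinear.Build _ _ _ _ f flin) (GRing.isMonoidMorphism.Build _ _ f fmul).
have Fstar : star_preserving F.
  move=> a; rewrite -[LHS]/(j (conv_single 1%g (star a))).
  by rewrite -[RHS]/(star (j (conv_single 1%g a))) -jstar conv_single_star invg1 act_1.
have su g : star (u g) = j (conv_single g^-1%g 1).
  by rewrite /u -jstar conv_single_star star1 rmorph1.
have uu g : star (u g) * u g = 1 /\ u g * star (u g) = 1.
  rewrite su /u -!rmorphM !conv_singleM !mul1r !rmorph1 mulVg mulgV.
  by rewrite conv_single1 rmorph1.
have uM g h : u (g * h)%g = u g * u h.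
  by rewrite /u -rmorphM conv_singleM mul1r rmorph1.
have cov g a : F (alpha g a) = u g * F a * star (u g).
  rewrite su -[F a]/(j (conv_single 1%g a)) /u -!rmorphM !conv_singleM.
  by rewrite mul1r rmorph1 mulr1 mulg1 mulgV.
exists (CovariantRep Fstar uu uM cov) => x.
rewrite [in RHS](conv_sum_single x) linear_sum; apply: eq_bigr => g _.
rewrite -[LHS]/(f (x g) * u g) /f /u -rmorphM conv_singleM.
by rewrite mul1g rmorph1 mulr1.
Qed.

End CovariantRepresentation.

Section CrossedProduct.
Variables (R : realType) (G : finGroupType) (U : cstarAlgType R).
Variables (alpha : cstar_action G U) (B : cstarAlgType R).
Variable r : covariant_rep alpha B.

Local Notation "'pi'" := (cov_pi r).
Local Notation u := (cov_u r).

Lemma pi_norm a : cnorm (pi a) <= cnorm a.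
Proof. exact/star_morph_contractive/cov_pi_star. Qed.

Lemma cov_u1 : u 1%g = 1.
Proof.
have [u1 _] := cov_u_unitary r 1%g.
by rewrite -[LHS]mul1r -u1 -mulrA -cov_uM mulg1.
Qed.

Lemma cov_uV g : star (u g) = u g^-1%g.
Proof.
have [_ uu] := cov_u_unitary r g.
by rewrite -[LHS]mul1r -cov_u1 -(mulVg g) cov_uM -mulrA uu mulr1.
Qed.

Lemma cov_u_norm g : cnorm (u g) = 1.
Proof. by apply: cnorm_unitary; case: (cov_u_unitary r g). Qed.

Lemma cov_swap g a : pi a * u g = u g * pi (alpha g^-1%g a).
Proof.
rewrite covariance cov_uV invgK !mulrA -cov_uM mulgV cov_u1 mul1r //.
Qed.

(* The projections [alpha_g p] are almost orthogonal with sum almost 1,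
   so the [u_g p] can be corrected to partial isometries [f_g] with source [p]
   and orthogonal ranges summing to 1.  As [p] almost commutes with
   the given elements, [pi a u_g] is close to the sum over [h] of
   [f_gh pi (p b p) f_h^*], where [b = alpha_gh^-1 a]. *)
Lemma rokhlin_approximation : Rokhlin alpha -> locally_matricial 1 U ->
  forall (s : seq U) (e : R), 0 < e ->
  exists m (E : 'I_m.+1 -> 'I_m.+1 -> B), is_mu E /\
    {in s, forall a, forall g, exists y, cnorm (pi a * u g - mxev E y) < e}.
Proof.
move=> hR locU s e e0; have [M M0 sM] := norm_bound s.
pose n : R := #|G|%:R; have n0 : 0 <= n := ler0n _ _.
(* The final sum has [n] terms, each at most [c0 * (4 * M + 4)], which is half of [e / (n + 1)]. *)
pose c0 := e / ((8 * M + 8) * (n + 1)).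
have c00 : 0 < c0 by rewrite divr_gt0 // mulr_gt0; lra.
have c0E : c0 * ((8 * M + 8) * (n + 1)) = e.
  by rewrite divfK // gt_eqF // mulr_gt0; lra.
have [c [c_gt0 c1 cc]] : exists c : R, [/\ 0 < c, c <= 1 & c <= c0].
  by exists (Num.min 1 c0); rewrite lt_min c00 ltr01 !ge_min !lexx orbT.
have [d d0 gs] := gram_schmidt_unital B G c_gt0.
have [d' [d'0 d'd d'c d'2]] : exists d', [/\ 0 < d', d' <= d, d' <= c & d' <= 2^-1].
  exists (Num.min d (Num.min c 2^-1)).
  by rewrite !lt_min d0 c_gt0 invr_gt0 ltr0n !ge_min !lexx !orbT.
(* Moving [a] through a unitary produces its translates; these too must almost commute with [p] and
   be approximated by matrices. *)
pose s' := [seq alpha g a | a <- s, g <- enum G].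
have s'P a g : a \in s -> alpha g a \in s'.
  by move=> a_s; apply: allpairs_f; rewrite ?mem_enum.
have [p [hp pcomm porth psum]] := rokhlin_projection hR s' d'0.
have [pp sp] := hp; pose P := pi p.
have hP : is_proj P by split; rewrite /P -?rmorphM ?pp // -cov_pi_star sp.
have conjP g : u g * P * star (u g) = pi (alpha g p) by rewrite covariance.
pose S (_ : B) := True.
have hS : closed_subalg S by split.
have [//|//|i|i k||f [ff f1 _ fx]] := gs P S (fun g => u g * P) hP hS _ I _.
- by rewrite -mulrA (proj1 hP).
- apply: le_trans d'd; rewrite starM (proj2 hP) cov_uV.
  have -> : P * u i^-1%g * (u k * P) = P * u (i^-1 * k)%g * P by rewrite cov_uM !mulrA.
  have [->|ik] := eqVneq i k.
    by rewrite mulVg cov_u1 mulr1 (proj1 hP) subrr cnorm0 ltW.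
  (* With [x] for [i^-1 * k], the off-diagonal Gram entry is [u x] times the image of
     [alpha x^-1 p * p], which is small. *)
  rewrite subr0 /P cov_swap -mulrA -rmorphM.
  have := porth (i^-1 * k)^-1%g; rewrite eq_invg1 -eq_mulVg1 => /(_ ik) h.
  have := cnormM_le_of (lexx (cnorm (u (i^-1 * k)%g))) (le_trans (pi_norm _) h).
  by rewrite cov_u_norm mul1r.
- have -> : \sum_g u g * P * star (u g * P) - 1 = pi (\sum_g alpha g p - 1).
    rewrite raddfB /= rmorph1 raddf_sum; congr (_ - _); apply: eq_bigr => g _ /=.
    by rewrite starM (proj2 hP) mulrA -(mulrA (u g)) (proj1 hP) conjP.
  exact: le_trans (pi_norm _) (le_trans psum d'2).
(* Small enough for [6 * (41 * dl) <= c], the distance from [v] to [p]. *)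
pose dl := c / 1000.
have dl0 : 0 < dl by rewrite /dl; lra.
(* The projection [p] need not lie in a matrix subalgebra; [v] carries it to a nearby [q] in the
   range of [E]. *)
have [k [E [hE _ Es]]] := locU (p :: s') dl dl0.
have [yp pyp] := Es p (mem_head _ _); rewrite cnorm_distC in pyp.
have dl64 : dl <= 64^-1 by rewrite /dl; lra.
have [q [hq [q0 qE] pq]] := near_projection_of (mx_range_closed_subalg hE)
  (fun y => mx_range_star hE) hp (ex_intro _ yp erefl) (ltW pyp) dl64.
rewrite cnorm_distC in pq; have dl16 : 41 * dl <= 16^-1 by rewrite /dl; lra.
have [v [vv vv' vp]] := close_projections hp hq pq dl16.
have {}vp : cnorm (v - p) <= c by rewrite /dl in vp; lra.
have vE : v * p = v := isometry_proj hp vv.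
have qv : q * v = v by rewrite -vv' -mulrA vv.
have q0q0 : q0 *m q0 = q0.
  by apply: (mxev_inj hE); rewrite mxevM // -qE; case: hq.
have q0s : map_mx Num.conj q0^T = q0.
  by apply: (mxev_inj hE); rewrite mxev_star // -qE; case: hq.
(* [V] identifies the corner of [q0] with the matrices of size [l]. Below, [w] is the image of their
   units, and [t g] is [f g] with its source moved from [P] to the image of [q]. *)
have [l [V [VV V1]]] := mx_proj_factor q0q0 q0s.
set Vs := map_mx _ _ in VV V1.
pose t g := f g * pi (star v); pose w a b := pi (mxev E (V *m delta_mx a b *m Vs)).
have fP i : f i * P = f i by apply: isometry_proj hP _; rewrite ff eqxx.
have tt i h : star (t i) * t h = if i == h then pi q else 0.
  rewrite /t starM -cov_pi_star starK mulrA -(mulrA (pi v)) ff.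
  case: eqP => _; last by rewrite mulr0 mul0r.
  by rewrite -!rmorphM vE vv'.
have tq i : t i * pi q = t i.
  by rewrite /t -mulrA -rmorphM -{1}(proj2 hq) -starM qv.
have t1 : \sum_i t i * star (t i) = 1.
  rewrite -f1; apply: eq_bigr => i _; rewrite /t starM -cov_pi_star starK.
  by rewrite mulrA -(mulrA (f i)) -rmorphM vv fP.
have hmu : is_mu (fun x y : G * 'I_l => t x.1 * w x.2 y.2 * star (t y.1)).
  apply: (mu_amplify tt tq t1) => [a b a' b'|a b|].
  - rewrite /w -rmorphM -mxevM //.
    have -> : V *m delta_mx a b *m Vs *m (V *m delta_mx a' b' *m Vs) =
      V *m (delta_mx a b *m (Vs *m V) *m delta_mx a' b') *m Vs by rewrite !mulmxA.
    rewrite V1 mulmx1 mul_delta_mx_cond; case: (b == a') => //.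
    by rewrite mulr0n mulmx0 mul0mx mxev0 raddf0.
  - rewrite /w -cov_pi_star -mxev_star //; congr (pi (mxev E _)).
    rewrite !ctmx_mul ctmxK mulmxA; congr (_ *m _ *m _).
    apply/matrixP => x y; rewrite !mxE andbC.
    by case: (_ && _); rewrite ?rmorph1 ?rmorph0.
  rewrite /w qE -raddf_sum -mxev_sum -mulmx_suml -mulmx_sumr -mx1_sum_delta.
  by rewrite mulmx1 VV.
have [m [F [hF FE]]] := mu_ord hmu; exists m, F; split=> // a a_s g.
pose b h := alpha (g * h)^-1%g a.
have [y yP] : exists y : G -> 'M[R[i]]_k.+1, forall h, cnorm (b h - mxev E (y h)) < dl.
  have hb h : exists y, cnorm (b h - mxev E y) < dl.
    by apply: Es; rewrite inE s'P ?orbT.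
  by have [y yP] := choice hb; exists y.
(* Compression by [q0] puts the middle factor in the span of the [w i j], hence [z h] in the range
   of [F]. *)
pose z h := t (g * h)%g * pi (mxev E (q0 *m y h *m q0)) * star (t h).
have zF h : mx_range F (z h).
  have hFs := mx_range_closed_subalg hF.
  have -> : z h = \sum_i \sum_j (Vs *m y h *m V) i j *:
      (t (g * h)%g * w i j * star (t h)).
    rewrite /z -VV; have -> : V *m Vs *m y h *m (V *m Vs) =
      V *m (Vs *m y h *m V) *m Vs by rewrite !mulmxA.
    set N := Vs *m y h *m V; rewrite {1}(matrix_sum_delta N).
    rewrite mulmx_sumr mulmx_suml mxev_sum linear_sum mulr_sumr mulr_suml.
    apply: eq_bigr => i _.
    rewrite mulmx_sumr mulmx_suml mxev_sum linear_sum mulr_sumr mulr_suml.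
    apply: eq_bigr => j _; rewrite /= -scalemxAr -scalemxAl mxevZ linearZ /=.
    by rewrite -scalerAr -scalerAl.
  apply: csub_sum => // i _; apply: csub_sum => // j _; apply: (csubZ hFs).
  by have [y' y'E] := FE ((g * h)%g, i) (h, j); exists y'.
have [Y YE] : mx_range F (\sum_h z h).
  by apply: csub_sum => [|h _]; [apply: mx_range_closed_subalg|apply: zF].
exists Y; rewrite -YE.
have -> : pi a * u g = \sum_h pi a * u g * f h * star (f h).
  by rewrite -{1}[pi a * u g]mulr1 -f1 mulr_sumr; apply: eq_bigr => h _; rewrite mulrA.
rewrite -sumrB; apply: le_lt_trans (cnorm_sum_le _ _ _) _.
apply: (@le_lt_trans _ _ (\sum_(h : G) (c0 * (4 * M + 4)))); last first.
  rewrite sumr_const -mulr_natl -/n; have := mulr_ge0 (ltW c00) n0.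
  have := mulr_ge0 (mulr_ge0 (ltW c00) n0) M0; have := mulr_ge0 (ltW c00) M0.
  by lra.
apply: ler_sum => h _.
pose x := star v * mxev E (y h) * v.
have zE : z h = f (g * h)%g * pi x * star (f h).
  rewrite /z /t !mxevM // -qE starM -cov_pi_star starK.
  have -> : x = star v * (q * mxev E (y h) * q) * v.
    rewrite /x !mulrA -(mulrA _ q v) qv; congr (_ * _ * _).
    by rewrite -(proj2 hq) -starM qv.
  by rewrite !rmorphM !mulrA.
have fn i : cnorm (f i) <= 1 by apply: isometry_norm_le1 hP _; rewrite ff eqxx.
have sfn i : cnorm (star (f i)) <= 1 by rewrite cnorm_starE.
rewrite zE -mulrBl; apply: le_trans (cnormM_le_of (lexx _) (sfn h)) _; rewrite mulr1.
have an := sM a a_s; have pn := proj_norm_le1 hp.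
have vn := isometry_norm_le1 hp vv.
have svn : cnorm (star v) <= 1 by rewrite cnorm_starE.
have bn : cnorm (b h) <= M by rewrite cstar_iso_norm.
(* Replace [f h] by [u h * P], move [a] to the right of [u (g * h)] where it becomes [b h], replace
   [b h * p] by [x], and finally return from [u (g * h) * P] to [f (g * h)]. *)
have ex1 : pi a * u g * f h - f (g * h)%g * pi x =
  pi a * u g * (f h - u h * P) + u (g * h)%g * pi (b h * p - x) +
  (u (g * h)%g * P - f (g * h)%g) * pi x.
  have -> : u (g * h)%g * pi (b h * p - x) =
      pi a * u g * (u h * P) - u (g * h)%g * pi x.
    have <- : u (g * h)%g * pi (b h * p) = pi a * u g * (u h * P).
      by rewrite rmorphM /= mulrA /b -(cov_swap (g * h)%g a) cov_uM !mulrA.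
    by rewrite -mulrBr -raddfB.
  have Px : P * pi x = pi x by rewrite -rmorphM /x !mulrA -{1}sp -starM vE.
  have -> : (u (g * h)%g * P - f (g * h)%g) * pi x =
    u (g * h)%g * pi x - f (g * h)%g * pi x by rewrite mulrBl -mulrA Px.
  by ncring.
have E1 : cnorm (pi a * u g * (f h - u h * P)) <= M * 1 * c.
  apply: cnormM_le_of (fx h); apply: cnormM_le_of; last by rewrite cov_u_norm.
  exact: le_trans (pi_norm a) an.
have bx : b h * p - x = (b h * p - p * b h) * p + (p - star v) * b h * p +
    star v * b h * (p - v) + star v * (b h - mxev E (y h)) * v.
  rewrite /x !(mulrBl, mulrBr) -!mulrA pp; ncring.
have bxn : cnorm (b h * p - x) <= d' * 1 + c * M * 1 + 1 * M * c + 1 * dl * 1.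
  rewrite bx; apply: le_trans (cnormD_le _ _) _; apply: lerD; last first.
    by apply: cnormM_le_of vn; apply: cnormM_le_of svn (ltW (yP h)).
  apply: le_trans (cnormD_le _ _) _; apply: lerD; last first.
    by apply: cnormM_le_of (cnormM_le_of svn bn) _; rewrite cnorm_distC.
  apply: le_trans (cnormD_le _ _) _; apply: lerD.
    by apply: cnormM_le_of pn; apply: pcomm; apply: s'P.
  apply: cnormM_le_of pn; apply: cnormM_le_of bn.
  by rewrite -{1}sp -starB cnorm_starE cnorm_distC.
have E2 : cnorm (u (g * h)%g * pi (b h * p - x)) <=
    1 * (d' * 1 + c * M * 1 + 1 * M * c + 1 * dl * 1).
  by apply: cnormM_le_of; [rewrite cov_u_norm | apply: le_trans (pi_norm _) bxn].
have xn : cnorm x <= 1 * (M + 1) * 1.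
  apply: cnormM_le_of vn; apply: cnormM_le_of svn _.
  have := cnorm_le_dist (mxev E (y h)) (b h); rewrite cnorm_distC.
  by have := yP h; rewrite /dl; lra.
have E3 : cnorm ((u (g * h)%g * P - f (g * h)%g) * pi x) <= c * (1 * (M + 1) * 1).
  by apply: cnormM_le_of; [rewrite cnorm_distC | apply: le_trans (pi_norm _) xn].
rewrite ex1; apply: le_trans (cnormD_le _ _) _.
apply: le_trans (lerD (cnormD_le _ _) (lexx _)) _.
apply: le_trans (lerD (lerD E1 E2) E3) _.
have := ler_wpM2r M0 cc; rewrite /dl; lra.
Qed.

End CrossedProduct.

(** * Local matriciality and generation of the crossed product *)

Section CrossedProductUHF.
Variables (R : realType) (G : finGroupType) (U : cstarAlgType R).
Variables (alpha : cstar_action G U) (B : cstarAlgType R).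
Variable r : covariant_rep alpha B.
Hypothesis r_dense : forall (b : B) (e : R), 0 < e ->
  exists f, cnorm (b - integrated_form r f) < e.

Lemma crossed_product_locally_matricial1 : Rokhlin alpha ->
  locally_matricial 1 U -> locally_matricial 1 B.
Proof.
move=> hR locU s e e0; pose n : R := #|G|%:R; have n0 : 0 <= n := ler0n _ _.
have e2 : 0 < e / 2 by lra.
have [f fP] : exists f : B -> conv_alg alpha, forall b,
    cnorm (b - integrated_form r (f b)) < e / 2.
  by have [f fP] := choice (fun b => r_dense b e2); exists f.
pose c := e / 2 / (n + 1); have c0 : 0 < c by rewrite !divr_gt0 //; lra.
have cE : c * (n + 1) = e / 2 by rewrite divfK // gt_eqF //; lra.
have [m [E [hE Es]]] := rokhlin_approximation r hR locU
  [seq f b g | b <- s, g <- enum G] c0.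
exists m, E; split=> // b bs; rewrite ?dvd1n //.
have h g : exists y, cnorm (cov_pi r (f b g) * cov_u r g - mxev E y) < c.
  by apply: Es; apply: allpairs_f; rewrite ?mem_enum.
have {h} [y yP] := choice h.
exists (\sum_g y g).
apply: le_lt_trans (cnorm_dist_trans (integrated_form r (f b)) _ _) _.
suff : cnorm (integrated_form r (f b) - mxev E (\sum_g y g)) <= n * c.
  by have := fP b; lra.
rewrite mxev_sum -sumrB; apply: le_trans (cnorm_sum_le _ _ _) _.
rewrite /n mulr_natl -sumr_const; apply: ler_sum => g _; exact: ltW.
Qed.

Lemma crossed_product_locally_matricial : Rokhlin alpha ->
  (forall N, locally_matricial N.+1 U) -> forall N, locally_matricial N.+1 B.
Proof.
move=> hR locU N s e e0.
(* No element is approximated here: [E] only supplies a size divisible by [N.+1], which the system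
   of [B] containing its image inherits. *)
have [m [E [hE mN _]]] := locU N [::] e e0.
have hpi := mu_morph (cov_pi_star r) hE.
have [l [F [hF _ Fs FE]]] := locally_matricial_extend
  (crossed_product_locally_matricial1 hR (locU 0%N)) hpi s e0.
exists l, F; split=> //; apply: (dvdn_trans mN).
have h i : exists f : 'I_m.+1 -> 'M[R[i]]_l.+1, forall j,
    cov_pi r (E i j) = mxev F (f j).
  by have [f] := choice (FE i); exists f.
have [T TE] := choice h; apply: (@mu_mx_dvdn _ _ _ T); apply/(mu_mxev _ hF).
case: hpi => M1 S1 U1; split=> [i j k n|i j|].
- by rewrite -!TE.
- by rewrite -!TE.
by rewrite -U1; apply: eq_bigr => i _; rewrite TE.
Qed.

(** For fixed [g], the elements [a] with [cov_pi r a * cov_u r g] in [S] form a closed linear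
    subspace, because [cov_pi r] is contractive; finite sums of such products are dense. *)
Lemma crossed_product_generating (F : nat -> seq U) : generating F ->
  generating (fun k => [seq cov_pi r a * cov_u r g | a <- F k, g <- enum G]).
Proof.
move=> genF S Sc SD SZ SF x.
have Sg g a : S (cov_pi r a * cov_u r g).
  apply: (genF (fun a => S (cov_pi r a * cov_u r g))) => [b bS|b b'|c b|k b bF].
  - apply: Sc => e /bS[b' Sb' bb']; exists (cov_pi r b' * cov_u r g) => //.
    rewrite -mulrBl -raddfB; apply: le_lt_trans bb'.
    have := cnormM_le_of (pi_norm r (b - b')) (lexx (cnorm (cov_u r g))).
    by rewrite cov_u_norm mulr1.
  - by move=> Sb Sb'; rewrite rmorphD mulrDl; apply: SD.
  - by move=> Sb; rewrite linearZ /= -scalerAl; apply: SZ.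
  by apply: (SF k); apply: allpairs_f; rewrite ?mem_enum.
have S0 : S 0 by rewrite -(scale0r (cov_pi r 0 * cov_u r 1%g)); apply: SZ.
apply: Sc => e /(r_dense x)[f xf]; exists (integrated_form r f) => //.
by apply: big_ind.
Qed.

End CrossedProductUHF.

Theorem theorem4p4 (R : realType) (U : cstarAlgType R) (hU : universal_UHF U)
    (G : finGroupType) (alpha : cstar_action G U) (halpha : Rokhlin alpha)
    (B : cstarAlgType R) (j : {lrmorphism conv_alg alpha -> B})
    (hB : crossed_product j) :
  cstar_isomorphic B U.
Proof.
have [T supT] := hU; have locU := tower_locally_matricial supT.
have [r rj] := covariant_rep_of_morph (cp_star hB).
have r_dense b e : 0 < e -> exists f, cnorm (b - integrated_form r f) < e.
  by move=> /(cp_dense hB b)[f bf]; exists f; rewrite rj.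
apply: (locally_matricial_isomorphic
  (crossed_product_locally_matricial r_dense halpha locU) locU
  (crossed_product_generating r_dense (@tower_generating _ _ T))).
exact: tower_generating.
Qed.
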